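(* Let $G$ be a countable abelian group, $X$ a compact metrizable abelian group, and $\alpha$ an action of $G$ by (continuous) automorphisms $\alpha_g$ of $X$. Let $M=\widehat{X}$ be the Pontryagin dual of $X$, regarded as a $\mathbb{Z}[G]$-module via the dual automorphisms $\widehat{\alpha}_g$, and let $S\subset M$ be a set of generators of $M$ as a $\mathbb{Z}[G]$-module. Then $(X,\alpha)$ is expansive if and only if both of the following hold: (i) $M$ is a finitely generated $\mathbb{Z}[G]$-module; and (ii) for every $s\in S$, with annihilator $\mathfrak{a}=\{f\in\mathbb{Z}[G]: fs=0\}$, there is no ring homomorphism $\phi:\mathbb{Z}[G]/\mathfrak{a}\rightarrow\mathbb{C}$ for which $\phi(\overline{G})$ is a subgroup of the unit circle, where $\overline{G}$ denotes the image of $G$ under the quotient map $\mathbb{Z}[G]\to\mathbb{Z}[G]/\mathfrak{a}$.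
   Context: Expansiveness: for an action $\alpha$ of $G$ by automorphisms of the compact abelian group $X$, the system $(X,\alpha)$ is expansive if there is a neighbourhood $N$ of $0$ in $X$ such that $\bigcap_{g\in G}\alpha_g(N)=\{0\}$. Module structure: $\mathbb{Z}[G]$ is the integral group ring of $G$. The dual group $M=\widehat{X}$ (a countable discrete abelian group, written additively) is a $\mathbb{Z}[G]$-module by $fa=\sum_{g\in G}c_g\widehat{\alpha}_g(a)$ for $a\in M$ and $f=\sum_{g\in G}c_g g\in\mathbb{Z}[G]$, where $c_g\in\mathbb{Z}$ and $c_g=0$ for all but finitely many $g$, and where $\widehat{\alpha}_g$ is the automorphism of $\widehat{X}$ dual to $\alpha_g$. The unit circle is the multiplicative group $\{z\in\mathbb{C}:|z|=1\}$. *)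

(* Defs.v *)
From HB Require Import structures.
From mathcomp Require Import all_boot all_order all_algebra finmap.
From mathcomp Require Import all_classical all_reals all_analysis.
From mathcomp Require Import complex.
(* The notations of monalg are incompatible with those of mathcomp-analysis. *)
From mathcomp Require Import -(notations) monalg.

Set Implicit Arguments.
Unset Strict Implicit.
Unset Printing Implicit Defensive.

Import Order.TTheory GRing.Theory Num.Theory.
Import numFieldNormedType.Exports.

Local Open Scope classical_set_scope.
Local Open Scope ring_scope.

(* The group G is written additively. The finitely supported functions       *)
(* G -> int form the type malg G int of monalg; monalg only turns it into a   *)
(* ring when 0 is the only invertible element of G, so the convolution        *)
(* product is set up here on an alias.                                        *)
Definition group_ring (G : zmodType) : Type := malg G int.

Section GroupRing.
Variable G : zmodType.

HB.instance Definition _ := GRing.Zmodule.copy (group_ring G) (malg G int).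

Implicit Types (f g h : group_ring G) (k l : G).

Definition gr_of k : group_ring G := mkmalgU k 1.

Definition gr_mul f g : group_ring G :=
  \sum_(k <- msupp f) \sum_(l <- msupp g)
     mkmalgU (k + l) (mcoeff k f * mcoeff l g).

(* \sum_k F k *~ f_k, the additive extension of F : G -> V to the group ring *)
Definition gr_sum (V : zmodType) (F : G -> V) f : V :=
  \sum_(k <- msupp f) F k *~ mcoeff k f.

Lemma gr_sumEw (V : zmodType) (F : G -> V) (d : {fset G}) f :
  fsubset (msupp f) d -> gr_sum F f = \sum_(k <- d) F k *~ mcoeff k f.
Proof.
move=> le; rewrite /gr_sum (big_fset_incl _ le) //= => k _ /mcoeff_outdom ->.
by rewrite mulr0z.
Qed.

Lemma gr_sumD (V : zmodType) (F : G -> V) f g :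
  gr_sum F (f + g) = gr_sum F f + gr_sum F g.
Proof.
rewrite (gr_sumEw F (msuppD_le f g)) (gr_sumEw F (fsubsetUl _ (msupp g))).
rewrite (gr_sumEw F (fsubsetUr (msupp f) _)) -big_split /=.
by apply: eq_bigr => k _; rewrite mcoeffD mulrzDr.
Qed.

Lemma gr_sum0 (V : zmodType) (F : G -> V) : gr_sum F 0 = 0.
Proof. by rewrite /gr_sum msupp0 big_seq_fset0. Qed.

Lemma gr_sumU (V : zmodType) (F : G -> V) k (c : int) :
  gr_sum F (mkmalgU k c) = F k *~ c.
Proof. by rewrite (gr_sumEw F msuppU_le) big_seq_fset1 mcoeffUU. Qed.

Lemma gr_sum_morph (V W : zmodType) (h : {additive V -> W}) (F : G -> V) f :
  h (gr_sum F f) = gr_sum (h \o F) f.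
Proof. by rewrite raddf_sum; apply: eq_bigr => k _; rewrite raddfMz. Qed.

Lemma eq_gr_sum (V : zmodType) (F F' : G -> V) f :
  F =1 F' -> gr_sum F f = gr_sum F' f.
Proof. by move=> e; apply: eq_bigr => k _; rewrite e. Qed.

Lemma gr_sum_split (V : zmodType) (F F' : G -> V) f :
  gr_sum (fun k => F k + F' k) f = gr_sum F f + gr_sum F' f.
Proof. by rewrite -big_split; apply: eq_bigr => k _; rewrite /= mulrzDl. Qed.

Lemma gr_sum_exchange (V : zmodType) (F : G -> G -> V) f g :
  gr_sum (fun k => gr_sum (F k) g) f =
  gr_sum (fun l => gr_sum (fun k => F k l) f) g.
Proof.
rewrite /gr_sum; under eq_bigr do rewrite mulrz_suml.
rewrite exchange_big; apply: eq_bigr => l _.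
by rewrite mulrz_suml; apply: eq_bigr => k _; rewrite mulrzAC.
Qed.

Lemma mkmalgU_gr_of k (c : int) : mkmalgU k c = gr_of k *~ c.
Proof.
by rewrite /gr_of -[in LHS](intz c) (raddfMz (@mkmalgU G int k)).
Qed.

Lemma gr_sum_of f : gr_sum gr_of f = f.
Proof.
by rewrite [RHS]monalgE; apply: eq_bigr => k _; rewrite -mkmalgU_gr_of.
Qed.

Lemma gr_mulE f g :
  gr_mul f g = gr_sum (fun k => gr_sum (fun l => gr_of (k + l)) g) f.
Proof.
apply: eq_bigr => k _; rewrite /gr_sum mulrz_suml; apply: eq_bigr => l _.
by rewrite mkmalgU_gr_of mulrC mulrzA.
Qed.

Lemma gr_sum_sum (V : zmodType) (F : G -> V) (H : G -> group_ring G) f :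
  gr_sum F (gr_sum H f) = gr_sum (fun k => gr_sum F (H k)) f.
Proof.
have addF : zmod_morphism (gr_sum F).
  by move=> a b; rewrite -[in RHS](subrK b a) [in RHS]gr_sumD addrK.
pose m := GRing.isZmodMorphism.Build (group_ring G) V (gr_sum F) addF.
pose hF : {additive group_ring G -> V} := HB.pack (gr_sum F) m.
exact: (gr_sum_morph hF).
Qed.

Lemma gr_sum_gr_of (V : zmodType) (F : G -> V) k : gr_sum F (gr_of k) = F k.
Proof. exact: gr_sumU. Qed.

Lemma gr_sum_mul (V : zmodType) (F : G -> V) f g :
  gr_sum F (gr_mul f g) = gr_sum (fun k => gr_sum (fun l => F (k + l)) g) f.
Proof.
rewrite gr_mulE gr_sum_sum; apply: eq_gr_sum => k.
by rewrite gr_sum_sum; apply: eq_gr_sum => l; rewrite gr_sum_gr_of.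
Qed.

Lemma gr_mulA : associative gr_mul.
Proof.
move=> f g h; rewrite [LHS]gr_mulE [RHS]gr_mulE gr_sum_mul.
apply: eq_gr_sum => k; rewrite gr_sum_mul.
by do 2![apply: eq_gr_sum => ?]; rewrite addrA.
Qed.

Lemma gr_mulC : commutative gr_mul.
Proof.
move=> f g; rewrite !gr_mulE gr_sum_exchange.
by do 2![apply: eq_gr_sum => ?]; rewrite addrC.
Qed.

Lemma gr_mul1 : left_id (gr_of 0) gr_mul.
Proof.
move=> f; rewrite gr_mulE gr_sum_gr_of -[RHS]gr_sum_of.
by apply: eq_gr_sum => k; rewrite add0r.
Qed.

Lemma gr_mulDl : left_distributive gr_mul +%R.
Proof. by move=> f g h; rewrite !gr_mulE gr_sumD. Qed.

Lemma gr_one_neq0 : gr_of 0 != 0.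
Proof. by rewrite /gr_of monalgU_eq0 oner_eq0. Qed.

HB.instance Definition _ := GRing.Zmodule_isComNzRing.Build (group_ring G)
  gr_mulA gr_mulC gr_mul1 gr_mulDl gr_one_neq0.

Lemma gr_ofD k l : gr_of (k + l) = gr_of k * gr_of l.
Proof. by rewrite [RHS]gr_mulE !gr_sum_gr_of. Qed.

End GroupRing.

Section Annihilator.
Variables (A : comNzRingType) (M : lmodType A).

Definition generates (S : set M) :=
  forall m : M, exists n (f : 'I_n -> A) (s : 'I_n -> M),
    (forall i, S (s i)) /\ m = \sum_(i < n) f i *: s i.

Definition finitely_generated := exists2 S : set M, finite_set S & generates S.

Definition ann (s : M) : pred A := [pred f | f *: s == 0].

Variable s : M.

Lemma ann_zmod_closed : zmod_closed (ann s).
Proof.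
split=> [|f g]; rewrite !inE ?scale0r // => /eqP fs /eqP gs.
by rewrite scalerBl fs gs subrr.
Qed.

HB.instance Definition _ := GRing.isZmodClosed.Build A (ann s) ann_zmod_closed.

Definition ann_ideal : zmodClosed A := GRing.ZmodClosed.clone A (ann s) _.

(* The ring A / ann s. The ring structure of {ideal_quot I} requires a proper *)
(* ideal, but ann 0 = A, so the (possibly zero) quotient ring is built here   *)
(* on top of the quotient group.                                              *)
Definition ann_quot : Type := {ideal_quot ann_ideal}.

HB.instance Definition _ := GRing.Zmodule.on ann_quot.

Definition ann_pi (f : A) : ann_quot := (\pi_({ideal_quot ann_ideal}) f)%qT.

Lemma ann_piP (f g : A) : ann_pi f = ann_pi g <-> (f - g) *: s = 0.
Proof.
have e : (f - g \in ann s) = (ann_pi f == ann_pi g) :=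
  Quotient.idealrBE ann_ideal f g.
by split=> [/eqP|/eqP h]; [rewrite -e inE => /eqP|apply/eqP; rewrite -e inE].
Qed.

Lemma ann_piB : {morph ann_pi : f g / f - g}.
Proof. exact: raddfB. Qed.

Lemma ann_piD : {morph ann_pi : f g / f + g}.
Proof. exact: raddfD. Qed.

Definition ann_repr (x : ann_quot) : A := repr (x : {ideal_quot ann_ideal}).

Lemma ann_reprK : cancel ann_repr ann_pi.
Proof. exact: reprK. Qed.

Definition ann_one : ann_quot := ann_pi 1.
Definition ann_mul (x y : ann_quot) : ann_quot :=
  ann_pi (ann_repr x * ann_repr y).

Lemma ann_mul_pi f g : ann_mul (ann_pi f) (ann_pi g) = ann_pi (f * g).
Proof.
have /ann_piP hf := ann_reprK (ann_pi f).
have /ann_piP hg := ann_reprK (ann_pi g).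
apply/ann_piP; set f' := ann_repr _; set g' := ann_repr _.
have -> : f' * g' - f * g = g' * (f' - f) + f * (g' - g).
  by rewrite !mulrBr ![g' * _]mulrC addrA subrK.
by rewrite scalerDl -!scalerA hf hg !scaler0 addr0.
Qed.

Lemma ann_mulA : associative ann_mul.
Proof.
move=> x y z; rewrite -[x]ann_reprK -[y]ann_reprK -[z]ann_reprK.
by rewrite !ann_mul_pi mulrA.
Qed.

Lemma ann_mulC : commutative ann_mul.
Proof. by move=> x y; rewrite /ann_mul mulrC. Qed.

Lemma ann_mul1 : left_id ann_one ann_mul.
Proof. by move=> x; rewrite -[x]ann_reprK ann_mul_pi mul1r. Qed.

Lemma ann_mulDl : left_distributive ann_mul +%R.
Proof.
move=> x y z; rewrite -[x]ann_reprK -[y]ann_reprK -[z]ann_reprK.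
by rewrite -ann_piD !ann_mul_pi -ann_piD mulrDl.
Qed.

HB.instance Definition _ := GRing.Zmodule_isComPzRing.Build ann_quot
  ann_mulA ann_mulC ann_mul1 ann_mulDl.

HB.instance Definition _ := GRing.isZmodMorphism.Build A ann_quot ann_pi ann_piB.

Lemma ann_pi_monoid : monoid_morphism ann_pi.
Proof. by split=> // f g; rewrite -ann_mul_pi. Qed.

HB.instance Definition _ :=
  GRing.isMonoidMorphism.Build A ann_quot ann_pi ann_pi_monoid.

End Annihilator.

Section Circle.
Variable R : realType.

Definition unit_circle : set R[i] := [set z | `|z| = 1].

Definition subgroup_of_circle (H : set R[i]) :=
  [/\ H `<=` unit_circle, H 1 & forall x y, H x -> H y -> H (x / y)].

End Circle.

Definition metrizable (R : realType) (X : topologicalType) :=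
  exists d : X -> X -> R,
  [/\ forall x y, d x y = 0 <-> x = y,
      forall x y, d x y = d y x,
      forall x y z, d x z <= d x y + d y z &
      forall x (N : set X),
        nbhs x N <-> exists2 e, 0 < e & [set y | d x y < e] `<=` N].

(* Pontryagin dual: continuous homomorphisms to the unit circle. R[i]^o is    *)
(* R[i] with the topology of its norm.                                        *)
Record dual (R : realType) (X : topologicalZmodType) := Character {
  char_fun :> X -> R[i]^o ;
  char_circle : forall x, unit_circle (char_fun x) ;
  charD : forall x y, char_fun (x + y) = char_fun x * char_fun y ;
  char_continuous : continuous char_fun
}.

Section Dual.
Variables (R : realType) (X : topologicalZmodType).
Local Notation M := (dual R X).
Implicit Types a b c : M.

HB.instance Definition _ := gen_eqMixin M.
HB.instance Definition _ := gen_choiceMixin M.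

Lemma dual_eq a b : (forall x, a x = b x) -> a = b.
Proof.
case: a b => [a a1 aD aC] [b b1 bD bC] /= /funext e.
by case: b / e b1 bD bC => *; congr Character; exact: Prop_irrelevance.
Qed.

Lemma char_neq0 a x : a x != 0.
Proof.
by rewrite -normr_eq0; have -> := char_circle a x; exact: oner_neq0.
Qed.

Lemma dual0_circle (x : X) : unit_circle (1 : R[i]).
Proof. exact: normr1. Qed.

Lemma dual0D (x y : X) : 1 = 1 * 1 :> R[i]^o.
Proof. by rewrite mulr1. Qed.

Lemma dual0_continuous : continuous (fun _ : X => 1 : R[i]^o).
Proof. by move=> x; exact: cvg_cst. Qed.

(* The group law of the dual is pointwise multiplication, written additively. *)
Definition dual0 : M := Character dual0_circle dual0D dual0_continuous.

Lemma dual_add_circle a b x : unit_circle (a x * b x).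
Proof.
rewrite /unit_circle /= normrM; have -> := char_circle a x.
by have -> := char_circle b x; rewrite mulr1.
Qed.

Lemma dual_addD a b x y :
  a (x + y) * b (x + y) = (a x * b x) * (a y * b y).
Proof. by rewrite !charD mulrACA. Qed.

Lemma dual_add_continuous a b : continuous (fun x => a x * b x : R[i]^o).
Proof. by move=> x; apply: cvgM; exact: char_continuous. Qed.

Definition dual_add a b : M :=
  Character (dual_add_circle a b) (dual_addD a b) (@dual_add_continuous a b).

Lemma dual_opp_circle a x : unit_circle (a x)^-1.
Proof.
by rewrite /unit_circle /= normfV; have -> := char_circle a x; rewrite invr1.
Qed.

Lemma dual_oppD a x y : (a (x + y))^-1 = (a x)^-1 * (a y)^-1.
Proof. by rewrite charD invfM. Qed.

Lemma dual_opp_continuous a : continuous (fun x => (a x)^-1 : R[i]^o).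
Proof.
by move=> x; apply: cvgV; [exact: char_neq0|exact: char_continuous].
Qed.

Definition dual_opp a : M :=
  Character (dual_opp_circle a) (dual_oppD a) (@dual_opp_continuous a).

Lemma dual_addA : associative dual_add.
Proof. by move=> a b c; apply: dual_eq => x; exact: mulrA. Qed.

Lemma dual_addC : commutative dual_add.
Proof. by move=> a b; apply: dual_eq => x; exact: mulrC. Qed.

Lemma dual_add0 : left_id dual0 dual_add.
Proof. by move=> a; apply: dual_eq => x; exact: mul1r. Qed.

Lemma dual_addN : left_inverse dual0 dual_opp dual_add.
Proof. by move=> a; apply: dual_eq => x; exact: mulVf (char_neq0 a x). Qed.

HB.instance Definition _ :=
  GRing.isZmodule.Build M dual_addA dual_addC dual_add0 dual_addN.

End Dual.

(* An action by continuous automorphisms; act0 and act_comp make each act g   *)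
(* a bijection with continuous inverse act (- g).                             *)
Record aut_action (G : zmodType) (X : topologicalZmodType) := AutAction {
  act :> G -> X -> X ;
  actD : forall g x y, act g (x + y) = act g x + act g y ;
  act_continuous : forall g, continuous (act g) ;
  act0 : forall x, act 0 x = x ;
  act_comp : forall g h x, act (g + h) x = act g (act h x)
}.

Definition expansive (G : zmodType) (X : topologicalZmodType)
    (alpha : aut_action G X) :=
  exists2 N : set X, nbhs 0 N & \bigcap_(g in [set: G]) (alpha g @` N) = [set 0].

Section DualAction.
Variables (R : realType) (G : zmodType) (X : topologicalZmodType).
Variable alpha : aut_action G X.
Implicit Types (a b : dual R X) (g h : G).

Lemma dual_act_circle g a x : unit_circle (a (alpha g x)).
Proof. exact: char_circle. Qed.

Lemma dual_actD g a x y :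
  a (alpha g (x + y)) = a (alpha g x) * a (alpha g y).
Proof. by rewrite actD charD. Qed.

Lemma dual_act_continuous g a : continuous (fun x => a (alpha g x)).
Proof.
move=> x; apply: continuous_comp; first exact: act_continuous.
exact: char_continuous.
Qed.

Definition dual_act g a : dual R X :=
  Character (dual_act_circle g a) (dual_actD g a) (@dual_act_continuous g a).

Lemma dual_act_is_additive g : zmod_morphism (dual_act g).
Proof. by move=> a b; exact: dual_eq. Qed.

HB.instance Definition _ g := GRing.isZmodMorphism.Build (dual R X) (dual R X)
  (dual_act g) (dual_act_is_additive g).

Lemma dual_act0 a : dual_act 0 a = a.
Proof. by apply: dual_eq => x /=; rewrite act0. Qed.

Lemma dual_act_comp g h a : dual_act (g + h) a = dual_act g (dual_act h a).
Proof. by apply: dual_eq => x /=; rewrite addrC act_comp. Qed.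

End DualAction.

(* The dual of X, an alias carrying the Z[G]-module structure given by alpha. *)
Definition dual_module (R : realType) (G : zmodType) (X : topologicalZmodType)
  (alpha : aut_action G X) : Type := dual R X.

Section DualModule.
Variables (R : realType) (G : zmodType) (X : topologicalZmodType).
Variable alpha : aut_action G X.
Local Notation M := (dual_module R alpha).

HB.instance Definition _ := GRing.Zmodule.copy M (dual R X).

Definition dual_scale (f : group_ring G) (a : M) : M :=
  \sum_(g <- msupp f) (dual_act alpha g a : M) *~ mcoeff g f.

Lemma dual_scaleE f a :
  dual_scale f a = gr_sum (fun g => dual_act alpha g a : M) f.
Proof. by []. Qed.

Lemma dual_scaleA f g a :
  dual_scale f (dual_scale g a) = dual_scale (f * g) a.
Proof.
rewrite [RHS]gr_sum_mul; apply: eq_gr_sum => k.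
rewrite [LHS](gr_sum_morph (dual_act alpha k)).
by apply: eq_gr_sum => l; rewrite dual_act_comp.
Qed.

Lemma dual_scale1 : left_id 1 dual_scale.
Proof. by move=> a; rewrite [LHS]gr_sum_gr_of dual_act0. Qed.

Lemma dual_scaleDr : right_distributive dual_scale +%R.
Proof.
move=> f a b; rewrite !dual_scaleE -gr_sum_split.
by apply: eq_gr_sum => k; rewrite (raddfD (dual_act alpha k)).
Qed.

Lemma dual_scaleDl a : {morph dual_scale^~ a : f g / f + g}.
Proof. by move=> f g; exact: gr_sumD. Qed.

HB.instance Definition _ := GRing.Zmodule_isLmodule.Build (group_ring G) M
  dual_scaleA dual_scale1 dual_scaleDr dual_scaleDl.

End DualModule.

Definition image_of_group (G : zmodType) (M : lmodType (group_ring G)) (s : M) :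
  set (ann_quot s) := [set ann_pi s (gr_of g) | g in [set: G]].
Arguments image_of_group {G M} s _.

(* Main.v *)
(* Write e(t) = exp(it) and let a character of Z[G] be "unitary" when it maps *)
(* G into the unit circle.                                                    *)
(* - Characters separate the points of X. For a bounded real function g and   *)
(*   an invariant mean M, h(x) = M(g(. + x) g) is positive definite. A weak   *)
(*   Bochner theorem (a positive definite function maximising a suitable      *)
(*   strictly convex functional is multiplicative) produces homomorphisms th  *)
(*   from the discrete group X to the circle with M |avg_s th^* g(. + c)|^2   *)
(*   bounded below for all finite s as soon as g is almost periodic; such a   *)
(*   th is automatically continuous.                                          *)
(* - Pontryagin duality. The powers of sum_a |1 + a(x) th(a)^*|^2 are sums of *)
(*   characters whose mean does not depend on the homomorphism th; as they    *)
(*   concentrate where a(x) is close to th(a), every th is an evaluation, and *)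
(*   a subgroup of the dual which separates points is everything. Hence an    *)
(*   expansive X has a finitely generated dual.                               *)
(* - If a unitary character phi kills the annihilator of s, Nakayama's lemma  *)
(*   yields a nonzero phi-equivariant psi : M -> C. The points of X given by  *)
(*   a |-> e(t Re psi(a)) have uniformly small orbits for small t, so X is    *)
(*   not expansive.                                                           *)
(* - Conversely, if no unitary character kills ann(s), compactness gives F in *)
(*   ann(s) which is bounded below on all unitary characters. A point with a  *)
(*   small orbit lifts to a small u : G -> R with s(g x) = e(u(g)); then      *)
(*   F * u takes values in 2 pi Z and is small, so F * u = 0, and u = 0 by    *)
(*   Wiener's lemma: for v = 1 - F/c one has u = v^n * u, while               *)
(*   |v^n|_1 <= (#supp v^n)^(1/2) |v^n|_2 tends to 0, the support growing     *)
(*   polynomially.                                                            *)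

Require Import Defs.
From HB Require Import structures.
From mathcomp Require Import all_boot all_order all_algebra.
From mathcomp Require Import all_classical all_reals all_analysis.
From mathcomp Require Import complex ring.

Set Implicit Arguments.
Unset Strict Implicit.
Unset Printing Implicit Defensive.

Import Order.TTheory GRing.Theory Num.Theory.
Import numFieldNormedType.Exports.

Local Open Scope classical_set_scope.
Local Open Scope ring_scope.

(** * Compactness and continuity *)

(** Everything is read off the characters. On the compact metrizable group X they separate points
    ([metrizable_separated]), every homomorphism from the dual to the circle is evaluation at a
    point ([dual_hom_eval]), and a subgroup of the dual that separates points is the whole dual
    ([separating_subgroup_full]). Invariant means on all bounded functions and the weak Bochner
    theorem [circle_hom_dominates] do the work of Haar measure and Fourier analysis here.

    Suppose the action is expansive with neighbourhood N. Closeness to 1 of finitely many characters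
    already confines a point to N, so the submodule they generate separates points and is all of M.
    If moreover a circle homomorphism of G, extended to Z[G], killed ann(s), then
    [equivariant_functional] would give a nonzero functional psi on M on which G acts by unimodular
    scalars. The point x with a(x) = exp(i tau Re psi(a)) would then have its whole orbit in N for
    small tau without being 0.

    Conversely, choose finitely many generators from S. As no circle homomorphism kills ann(s), some
    F in ann(s) is bounded below on all of them ([spectral_gap]). If the orbit of x stays near 0,
    then s(g x) = exp(i u(g)) with u small. The relation F s = 0 puts the values of F applied to u
    in 2 pi Z, smallness makes them 0, and [wiener_injective] gives u = 0. So each chosen generator
    is 1 on the orbit of x, hence every character is 1 at x, and x = 0. *)

Lemma compact_fip (T : topologicalType) (I : eqType) (K : set T)
    (P : I -> set T) :
  compact K -> (forall i, closed (P i)) ->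
  (forall s : seq I, exists2 x, K x & forall i, i \in s -> P i x) ->
  exists2 x, K x & forall i, P i x.
Proof.
move=> cK cP fip.
(* These sets are directed, as [B (s ++ t)] lies in both [B s] and [B t]; a cluster point of their
   filter lies in each closed [P i]. *)
pose B (s : seq I) := [set x | K x /\ forall i, i \in s -> P i x].
have FF : ProperFilter (filter_from setT B).
  apply: filter_from_proper; last first.
    by move=> s _; have [x Kx Px] := fip s; exists x; split.
  apply: filter_from_filter; first by exists [::].
  move=> s t _ _; exists (s ++ t) => // x [Kx Px].
  by split; split=> // i is_; apply: Px; rewrite mem_cat is_ ?orbT.
have FK : filter_from setT B K by exists [::] => // x [].
have [x [Kx clx]] := cK _ FF FK.
exists x => // i; apply: cP => U Ux.
apply: clx => //; exists [:: i] => // y [_]; apply; exact: mem_head.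
Qed.

Section Complex.
Variable R : realType.
Local Notation C := R[i]^o.

Lemma closed_eqf (T : topologicalType) (f g : T -> C) :
  continuous f -> continuous g -> closed [set x | f x = g x].
Proof.
move=> cf cg.
have -> : [set x | f x = g x] = (fun x => f x - g x) @^-1` [set 0].
  apply/seteqP; split=> x /=; first by move=> ->; rewrite subrr.
  by move=> /eqP; rewrite subr_eq0 => /eqP.
apply: preimage_closed => [x _|].
  by apply: continuousB; [exact: cf|exact: cg].
by apply: accessible_closed_set1; apply: hausdorff_accessible; exact: norm_hausdorff.
Qed.

(** In the order of R[i], 0 <= z means that z is real and nonnegative, that is z = |z|: an equation
    between continuous functions. *)
Lemma closed_gef (T : topologicalType) (f : T -> C) :
  continuous f -> closed [set x | 0 <= f x].
Proof.
move=> cf.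
have -> : [set x | 0 <= f x] = [set x | f x = `|f x|].
  by apply/seteqP; split=> x /= h; [rewrite ger0_norm|rewrite h].
apply: closed_eqf => // x; apply: continuous_comp; first exact: cf.
exact: norm_continuous.
Qed.

Lemma real_complex_continuous : continuous (fun x : R => x%:C%C : C).
Proof.
move=> x; apply/(@cvgrPdist_lt _ C) => e e0.
have eE : e = (complex.Re e)%:C%C by rewrite RRe_real// gtr0_real.
rewrite eE ltcR in e0; near=> y.
rewrite -rmorphB normc_def/= expr0n/= addr0 sqrtr_sqr eE ltcR.
by near: y; exact: cvgr_dist_lt.
Unshelve. all: by end_near. Qed.

Lemma compact_disk (r : R[i]) : compact [set z : C | `|z| <= r].
Proof.
pose f (z : R * R) : C := (z.1%:C + 'i * z.2%:C)%C.
have cf : continuous f.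
  move=> z; apply: cvgD; first exact: (continuous_comp (@cvg_fst _ _ _ _ _) (@real_complex_continuous _)).
  apply: cvgM; first exact: cvg_cst.
  exact: (continuous_comp (@cvg_snd _ _ _ _ _) (@real_complex_continuous _)).
pose a := complex.Re r.
have cA : compact (f @` (`[- a, a] `*` `[- a, a])).
  apply: continuous_compact; first exact: continuous_subspaceT.
  by apply: compact_setX; exact: segment_compact.
apply: (subclosed_compact _ cA).
  rewrite [X in closed X](_ : _ = [set z | 0 <= r - `|z|]); last first.
    by apply/seteqP; split=> z /=; rewrite subr_ge0.
  apply: closed_gef => z; apply: continuousB; first exact: cst_continuous.
  exact: norm_continuous.
move=> z /= zr; exists (complex.Re z, complex.Im z); last first.
  by rewrite /f [RHS]complexE.
have rE : r = a%:C%C by rewrite RRe_real// ger0_real// (le_trans _ zr).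
have ImE : (`|complex.Im z|%:C <= `|z|)%C.
  have := normc_ge_Re (z * 'i%C); rewrite ReiNIm normrN normrM.
  by rewrite [`|'i%C|]normc_def /= expr0n/= expr1n add0r sqrtr1 mulr1.
rewrite /= !in_itv/= -!ler_norml -!lecR -rE.
by rewrite (le_trans (normc_ge_Re z))// (le_trans ImE).
Qed.

Lemma complex_archimedean (a b : C) :
  0 <= a -> (forall N : nat, a * N.+1%:R <= b) -> a = 0.
Proof.
move=> a0 ab; have b0 : 0 <= b := le_trans (mulr_ge0 a0 (ler0n _ _)) (ab 0%N).
have aE : a = (complex.Re a)%:C%C by rewrite RRe_real// ger0_real.
have bE : b = (complex.Re b)%:C%C by rewrite RRe_real// ger0_real.
move: a0 ab; rewrite {}aE {}bE ler0c; set x := complex.Re a; set y := complex.Re b.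
rewrite le_eqVlt => /predU1P[<- //|x0] /(_ (Num.truncn (y / x))).
rewrite -(rmorph_nat (real_complex R)) -rmorphM lecR mulrC.
by rewrite -ler_pdivlMr// leNgt truncnS_gt.
Qed.

Section Continuity.
Variable T : topologicalType.
Implicit Types f g : T -> C.

Lemma cfunD f g : continuous f -> continuous g -> continuous (fun x => f x + g x).
Proof. by move=> cf cg x; apply: (@cvgD _ C); [exact: cf|exact: cg]. Qed.

Lemma cfunB f g : continuous f -> continuous g -> continuous (fun x => f x - g x).
Proof. by move=> cf cg x; apply: (@cvgB _ C); [exact: cf|exact: cg]. Qed.

Lemma cfunM f g : continuous f -> continuous g -> continuous (fun x => f x * g x).
Proof. by move=> cf cg x; apply: cvgM; [exact: cf|exact: cg]. Qed.

Lemma cfun_cst (c : C) : continuous (fun _ : T => c).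
Proof. by move=> x; exact: cvg_cst. Qed.

Lemma cfun_norm f : continuous f -> continuous (fun x => `|f x| : C).
Proof. by move=> cf x; apply: (@cvg_norm _ C); exact: cf. Qed.

Lemma cfun_conj f : continuous f -> continuous (fun x => (f x)^* : C).
Proof.
move=> cf x; apply/(@cvgrPdist_lt _ C) => e e0.
near=> y; rewrite -rmorphB norm_conjC.
by near: y; apply: (@cvgr_dist_lt _ C) => //; exact: cf.
Unshelve. all: by end_near. Qed.

Lemma cfun_sum (I : Type) (r : seq I) (F : I -> T -> C) :
  (forall i, continuous (F i)) -> continuous (fun x => \sum_(i <- r) F i x).
Proof.
move=> cF; elim: r => [|i r IH].
  by under eq_fun do rewrite big_nil; exact: cfun_cst.
by under eq_fun do rewrite big_cons; apply: cfunD => //; exact: cF.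
Qed.

End Continuity.

End Complex.

(** * Invariant means *)

Section FunctionSpace.
Variables (R : realType) (X : Type).
Local Notation C := R[i]^o.
Local Notation W := (prod_topology (fun _ : X => C)).

Lemma closed_forall (T : topologicalType) (I : Type) (P : I -> set T) :
  (forall i, closed (P i)) -> closed [set x | forall i, P i x].
Proof.
move=> cP x clx i; apply: cP => U /clx[y [Py Uy]].
by exists y; split.
Qed.

Lemma closed_imply (T : topologicalType) (Q : Prop) (P : set T) :
  (Q -> closed P) -> closed [set x | Q -> P x].
Proof.
move=> cP x clx q; apply: cP => // U /clx[y [Py Uy]].
by exists y; split=> //; exact: Py.
Qed.

Lemma continuous_eval (x : X) : continuous (fun u : W => u x).
Proof. exact: (@proj_continuous {classic X} (fun=> C) x). Qed.

Lemma compact_bounded_functions (B : X -> C) :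
  compact [set u : W | forall x, `|u x| <= B x].
Proof.
exact: (@tychonoff {classic X} (fun=> C) (fun x => [set z | `|z| <= B x])
  (fun x => @compact_disk R (B x))).
Qed.

End FunctionSpace.

Section Mean.
Variables (R : realType) (X : zmodType).
Local Notation C := R[i]^o.
Implicit Types (f g : X -> C).

Definition bdd f := exists B, forall x, `|f x| <= B.

(** An invariant mean. It is a total functional, but constrained on bounded functions only. *)
Record is_mean (M : (X -> C) -> C) := IsMean {
  mean1 : M (fun=> 1) = 1 ;
  meanD : forall f g, bdd f -> bdd g -> M (fun x => f x + g x) = M f + M g ;
  meanZ : forall c f, bdd f -> M (fun x => c * f x) = c * M f ;
  mean_ge0 : forall f, bdd f -> (forall x, 0 <= f x) -> 0 <= M f ;
  mean_shift : forall a f, bdd f -> M (fun x => f (x + a)) = M f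
}.

Lemma bddD f g : bdd f -> bdd g -> bdd (fun x => f x + g x).
Proof.
move=> [A hA] [B hB]; exists (A + B) => x.
by rewrite (le_trans (ler_normD _ _))// lerD.
Qed.

Lemma bddM f g : bdd f -> bdd g -> bdd (fun x => f x * g x).
Proof.
move=> [A hA] [B hB]; exists (A * B) => x.
by rewrite normrM ler_pM.
Qed.

Lemma bdd_cst (c : C) : bdd (fun=> c).
Proof. by exists `|c|. Qed.

Lemma bddN f : bdd f -> bdd (fun x => - f x).
Proof. by move=> [B hB]; exists B => x; rewrite normrN. Qed.

Lemma bdd_shift a f : bdd f -> bdd (fun x => f (x + a)).
Proof. by move=> [B hB]; exists B. Qed.

Lemma eq_bdd f g : f =1 g -> bdd f -> bdd g.
Proof. by move=> /funext ->. Qed.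

Lemma bdd_sum (I : Type) (r : seq I) (P : pred I) (F : I -> X -> C) :
  (forall i, P i -> bdd (F i)) -> bdd (fun x => \sum_(i <- r | P i) F i x).
Proof.
move=> bF; elim: r => [|i r IH].
  by apply: eq_bdd (bdd_cst 0) => x; rewrite big_nil.
case Pi: (P i); last by apply: eq_bdd IH => x; rewrite big_cons Pi.
by apply: eq_bdd (bddD (bF i Pi) IH) => x; rewrite big_cons Pi.
Qed.

Lemma bddX n f : bdd f -> bdd (fun x => f x ^+ n).
Proof.
move=> bf; elim: n => [|n IH]; first by apply: eq_bdd (bdd_cst 1) => x; rewrite expr0.
by apply: eq_bdd (bddM bf IH) => x; rewrite exprS.
Qed.

Lemma bdd_norm f : bdd f -> bdd (fun x => `|f x|).
Proof. by move=> [B hB]; exists B => x; rewrite normr_id. Qed.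

Definition cyclic_average (p : X * nat) f : X -> C :=
  fun y => p.2.+1%:R^-1 * \sum_(j < p.2.+1) f (y + p.1 *+ j).

Definition average (s : seq (X * nat)) f := foldr cyclic_average f s.

Lemma averageD s f g :
  average s (fun x => f x + g x) = (fun x => average s f x + average s g x).
Proof.
elim: s => //= p s ->; apply/funext => y.
by rewrite /cyclic_average big_split/= mulrDr.
Qed.

Lemma averageZ s c f : average s (fun x => c * f x) = (fun x => c * average s f x).
Proof.
elim: s => //= p s ->; apply/funext => y.
by rewrite /cyclic_average -mulr_sumr mulrCA.
Qed.

Lemma average1 s : average s (fun=> 1) = (fun=> 1).
Proof.
elim: s => //= p s ->; apply/funext => y.
by rewrite /cyclic_average sumr_const card_ord mulVf// pnatr_eq0.
Qed.

Lemma average_ge0 s f : (forall x, 0 <= f x) -> forall x, 0 <= average s f x.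
Proof.
elim: s => //= p s IH f0 y; rewrite mulr_ge0//.
by apply: sumr_ge0 => j _; exact: IH.
Qed.

Lemma cyclic_average_norm p f (B : C) :
  (forall x, `|f x| <= B) -> forall x, `|cyclic_average p f x| <= B.
Proof.
move=> fB x; rewrite normrM normfV normr_nat. rewrite ler_pdivrMl// mulr_natl.
rewrite (le_trans (ler_norm_sum _ _ _))// (le_trans (ler_sum _ (fun j _ => fB _)))//.
by rewrite sumr_const card_ord.
Qed.

Lemma average_norm s f (B : C) :
  (forall x, `|f x| <= B) -> forall x, `|average s f x| <= B.
Proof. by move=> fB; elim: s => //= p s IH; exact: cyclic_average_norm. Qed.

Lemma average_shift s a f :
  average s (fun x => f (x + a)) = (fun x => average s f (x + a)).
Proof.
elim: s => //= p s ->; apply/funext => y; rewrite /cyclic_average.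
by under eq_bigr do rewrite addrAC.
Qed.

(** Averaging along y, y + x, ..., y + N x makes the shift by x telescope, leaving two boundary
    terms over N + 1. The other averages in s commute with shifts and do not increase the sup
    norm. *)
Lemma average_almost_invariant s x N f (B : C) : (x, N) \in s ->
  (forall y, `|f y| <= B) ->
  forall y, `|average s (fun z => f (z + x)) y - average s f y| <= 2 * B / N.+1%:R.
Proof.
move=> + fB; elim: s => // -[a K] s IH; rewrite inE => /predU1P[[<- <-]|/IH{}IH] y.
  have hB := average_norm s fB; move: hB; rewrite /= average_shift.
  set h := average s f => hB.
  rewrite /cyclic_average/= -mulrBr -sumrB.
  have -> : \sum_(i < N.+1) (h (y + x *+ i + x) - h (y + x *+ i)) =
      h (y + x *+ N.+1) - h y.
    rewrite -(big_mkord xpredT (fun i => h (y + x *+ i + x) - h (y + x *+ i))).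
    rewrite (telescope_sumr_eq (fun i => h (y + x *+ i))) ?mulr0n ?addr0//.
    by move=> i _; rewrite -addrA -mulrSr.
  rewrite normrM mulrC normfV (ger0_norm (ler0n _ _)) ler_wpM2r ?invr_ge0//.
  by rewrite (le_trans (ler_normB _ _))// mulr_natl mulr2n lerD.
have -> : average ((a, K) :: s) (fun z => f (z + x)) y - average ((a, K) :: s) f y =
  cyclic_average (a, K) (fun z => average s (fun z => f (z + x)) z - average s f z) y.
  by rewrite /= /cyclic_average/= -mulrBr -sumrB.
exact: cyclic_average_norm.
Qed.

(** Abelian groups are amenable. Invariance under x is split into the closed conditions [P (x, N)],
    invariance up to an error of order 1/(N + 1). Finitely many of them hold for an iterated average
    evaluated at 0, and compactness gives all at once. *)
Lemma mean_exists : exists M, is_mean M.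
Proof.
pose W := prod_topology (fun _ : X -> C => C).
pose bound f : C := xget 0 [set B | forall x, `|f x| <= B].
have boundP f : bdd f -> forall x, `|f x| <= bound f.
  by move=> bf; exact: (xgetPex 0 bf).
(* Unbounded functions are sent to 0, so that all candidates lie in one compact product of disks. *)
pose B f := if `[< bdd f >] then bound f else 0.
have cE f := @continuous_eval R (X -> C) f.
pose E : set W := [set M | [/\ M (fun=> 1) = 1,
  forall f g, bdd f -> bdd g -> M (fun x => f x + g x) = M f + M g,
  forall c f, bdd f -> M (fun x => c * f x) = c * M f &
  forall f, bdd f -> (forall x, 0 <= f x) -> 0 <= M f]].
have clE : closed E.
  rewrite (_ : E = [set M : W | M (fun=> 1) = 1] `&`
    [set M : W | forall f g, bdd f -> bdd g -> M (fun x => f x + g x) = M f + M g] `&`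
    [set M : W | forall c f, bdd f -> M (fun x => c * f x) = c * M f] `&`
    [set M : W | forall f, bdd f -> (forall x, 0 <= f x) -> 0 <= M f]); last first.
    by apply/seteqP; split=> [M [? ? ? ?]|M [[[? ?] ?] ?]]; [do !split|split].
  apply: closedI; [apply: closedI; [apply: closedI|]|].
  - by apply: closed_eqf => //; exact: cst_continuous.
  - apply: closed_forall => f; apply: closed_forall => g.
    apply: closed_imply => _; apply: closed_imply => _.
    by apply: closed_eqf => //; apply: cfunD.
  - apply: closed_forall => c; apply: closed_forall => f.
    apply: closed_imply => _; apply: closed_eqf => //.
    by apply: cfunM => //; exact: cfun_cst.
  - apply: closed_forall => f; apply: closed_imply => _; apply: closed_imply => _.
    exact: closed_gef.
pose P (i : X * nat) : set W := [set M | forall f, bdd f ->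
  0 <= 2 * bound f / i.2.+1%:R - `|M (fun z => f (z + i.1)) - M f|].
have clP i : closed (P i).
  apply: closed_forall => f; apply: closed_imply => _; apply: closed_gef.
  by apply: cfunB; [exact: cfun_cst|apply: cfun_norm; exact: cfunB].
have := compact_fip (compact_closedI (@compact_bounded_functions R _ B) clE) clP.
case=> [s|M [bM [M1 MD MZ M0]] MP].
  exists (fun f => if `[< bdd f >] then average s f 0 else 0).
    split=> [f|].
      rewrite /B; case: asboolP => [bf|_]; last by rewrite normr0.
      by apply: average_norm; exact: boundP.
    split=> [|f g bf bg|c f bf|f bf f0].
    - by rewrite ifT ?average1//; apply/asboolP; exact: bdd_cst.
    - by rewrite !ifT ?averageD//; apply/asboolP => //; exact: bddD.
    - rewrite !ifT ?averageZ//; apply/asboolP => //.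
      by apply: bddM => //; exact: bdd_cst.
    - by rewrite ifT ?average_ge0//; apply/asboolP.
  move=> [x N] xs f bf /=; rewrite subr_ge0 !ifT; last 2 first.
  - by apply/asboolP.
  - by apply/asboolP; exact: bdd_shift.
  by apply: average_almost_invariant => //; exact: boundP.
exists M; split=> // a f bf; apply/eqP; rewrite -subr_eq0 -normr_eq0.
set z := M _ - _.
have zN N : `|z| <= 2 * bound f / N.+1%:R.
  by rewrite -subr_ge0; exact: (MP (a, N)).
apply/eqP; apply: (complex_archimedean (normr_ge0 z) (b := 2 * bound f)) => N.
by rewrite -ler_pdivlMr.
Qed.

End Mean.

(** * Positive definite functions *)

Section PositiveDefinite.
Variables (R : realType) (X : zmodType).
Local Notation C := R[i]^o.
Implicit Types (p q : X -> C) (s : seq (X * C)).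

Definition hermitian_sum p s := \sum_(u <- s) \sum_(v <- s) u.2 * v.2^* * p (u.1 - v.1).

Definition posdef p := forall s, 0 <= hermitian_sum p s.

Definition circle_hom (th : X -> C) :=
  (forall x y, th (x + y) = th x * th y) /\ (forall x, `|th x| = 1).

Definition lincomb (L : seq (X * C)) p : C := \sum_(u <- L) u.2 * p u.1.

Lemma circle_hom0 th : circle_hom th -> th 0 = 1.
Proof.
move=> [thD th1]; have th0 : th 0 != 0 by rewrite -normr_eq0 th1 oner_neq0.
by apply: (mulfI th0); rewrite -thD addr0 mulr1.
Qed.

Lemma circle_homN th x : circle_hom th -> th (- x) = (th x)^*.
Proof.
move=> hth; have [thD th1] := hth.
have thx : th x != 0 by rewrite -normr_eq0 th1 oner_neq0.
by apply: (mulfI thx); rewrite -thD subrr circle_hom0// -normCK th1 expr1n.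
Qed.

Lemma posdef_ge0 p : posdef p -> 0 <= p 0.
Proof.
move=> /(_ [:: (0, 1)]); rewrite /hermitian_sum !big_cons !big_nil /=.
by rewrite !addr0 subr0 rmorph1 !mul1r.
Qed.

Let hermitian_sum2 p x c : hermitian_sum p [:: (0, 1); (x, c)] =
  p 0 + c^* * p (- x) + (c * p x + c * c^* * p 0).
Proof.
rewrite /hermitian_sum !big_cons !big_nil /= !addr0 subr0 sub0r subrr.
by rewrite rmorph1 !mul1r mulr1 subr0.
Qed.

(** The two-point form at 0 and x with coefficients 1 and c is real; c = 1 and c = 'i give two
    equations that determine p(-x). *)
Lemma posdef_conj p x : posdef p -> p (- x) = (p x)^*.
Proof.
move=> pp; have p0 : (p 0)^* = p 0 by apply/CrealP/ger0_real/posdef_ge0.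
have real_c c : c * c^* = 1 -> (c^* * p (- x) + c * p x)^* = c^* * p (- x) + c * p x.
  move=> cc; apply/CrealP.
  have -> : c^* * p (- x) + c * p x = hermitian_sum p [:: (0, 1); (x, c)] - p 0 *+ 2.
    by rewrite hermitian_sum2 cc; ring.
  by rewrite rpredB ?rpredMn ?ger0_real//; exact: posdef_ge0.
have := real_c 1; rewrite rmorph1 mulr1 !mul1r => /(_ erefl) h1.
have := real_c 'i; rewrite -normCK normCi expr1n => /(_ erefl).
rewrite conjCi mulNr addrC -mulrBr rmorphM/= conjCi rmorphB/=.
rewrite mulNr -mulrN => /(mulfI (neq0Ci _)) hi.
move: h1; rewrite rmorphD/= => h1.
have : (p (- x)) *+ 2 = ((p x)^*) *+ 2.
  have -> : p (- x) *+ 2 = (p (- x) + p x) - (p x - p (- x)) by ring.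
  by rewrite -h1 -hi; ring.
by move=> /eqP; rewrite -subr_eq0 -mulrnBl mulrn_eq0/= subr_eq0 => /eqP.
Qed.

Lemma posdef_norm p x : posdef p -> `|p x| <= p 0.
Proof.
move=> pp; have [->|px0] := eqVneq (p x) 0; first by rewrite normr0 posdef_ge0.
have nx0 : `|p x| != 0 by rewrite normr_eq0.
(* With this phase c p(x) = -|p x|, and the two-point form becomes 2 (p 0 - |p x|). *)
pose c := - ((p x)^* / `|p x|).
have nc : c * c^* = 1.
  by rewrite -normCK normrN normf_div norm_conjC normr_id divff ?expr1n.
have := pp [:: (0, 1); (x, c)]; rewrite hermitian_sum2 nc (posdef_conj _ pp).
have cp : c * p x = - `|p x|.
  by rewrite /c mulNr mulrAC [_^* * _]mulrC -normCK expr2 mulfK.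
rewrite -rmorphM cp rmorphN/= (CrealP (normr_real _)).
have -> : p 0 - `|p x| + (- `|p x| + 1 * p 0) = (p 0 - `|p x|) * 2%:R by ring.
by rewrite pmulr_lge0 ?ltr0n// subr_ge0.
Qed.

Lemma posdefZ p c : 0 <= c -> posdef p -> posdef (fun x => c * p x).
Proof.
move=> c0 pp s; rewrite /hermitian_sum; under eq_bigr do under eq_bigr do rewrite mulrCA.
by under eq_bigr do rewrite -mulr_sumr; rewrite -mulr_sumr; exact: mulr_ge0 c0 (pp s).
Qed.

(** For |c| = 1 this is half of p convolved with delta_0 + c delta_x and with its adjoint, up to the
    sign convention for translations, hence positive definite again. *)
Definition twist p x c y := p y + (c * p (y + x) + c^* * p (y - x)) / 2.

Lemma posdef_twist p x c : posdef p -> `|c| = 1 -> posdef (twist p x c).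
Proof.
move=> pp nc s.
have := pp (s ++ [seq (u.1 + x, c * u.2) | u <- s]).
rewrite {1}/hermitian_sum big_cat/= big_map.
under eq_bigr do rewrite big_cat/= big_map/=.
under [X in _ + X]eq_bigr do rewrite big_cat/= big_map/=.
rewrite !big_split/= -!big_split/=.
under eq_bigr do rewrite -!big_split/=.
have cc : c * c^* = 1 by rewrite -normCK nc expr1n.
rewrite (eq_bigr (fun u => 2 * \sum_(v <- s) u.2 * v.2^* * twist p x c (u.1 - v.1))).
  by rewrite -mulr_sumr pmulr_rge0.
move=> u _; rewrite mulr_sumr; apply: eq_bigr => v _.
rewrite /twist.
have -> : u.1 - (v.1 + x) = u.1 - v.1 - x by rewrite opprD addrA.
have -> : u.1 + x - v.1 = u.1 - v.1 + x by rewrite addrAC.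
have -> : u.1 + x - (v.1 + x) = u.1 - v.1 by rewrite opprD addrACA subrr addr0.
rewrite !rmorphM/=.
have -> : c * u.2 * (c^* * v.2^*) * p (u.1 - v.1) =
  (c * c^*) * (u.2 * v.2^* * p (u.1 - v.1)) by ring.
rewrite cc.
by field.
Qed.

End PositiveDefinite.

(** * A weak Bochner theorem by convex maximisation *)

Section BochnerWeak.
Variables (R : realType) (X : zmodType).
Local Notation C := R[i]^o.
Local Notation W := (prod_topology (fun _ : X => C)).
Implicit Types (p q : X -> C) (L : seq (X * C)).

Lemma circle_hom_trivial : circle_hom (fun _ : X => 1 : C).
Proof. by split=> *; rewrite ?mulr1 ?normr1. Qed.

Lemma lincombD L p q : lincomb L (fun x => p x + q x) = lincomb L p + lincomb L q.
Proof. by rewrite /lincomb -big_split; apply: eq_bigr => u _; rewrite mulrDr. Qed.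

Lemma lincombZ L c p : lincomb L (fun x => c * p x) = c * lincomb L p.
Proof. by rewrite /lincomb mulr_sumr; apply: eq_bigr => u _; rewrite mulrCA. Qed.

Lemma continuous_Re : continuous (fun z : C => complex.Re z : R).
Proof.
move=> z; apply/(@cvgrPdist_lt _ R _ _ (nbhs_filter (z : C))) => e e0.
have e0' : 0 < e%:C%C :> C by rewrite ltcR.
have := @cvgr_dist_lt _ C _ _ (nbhs_filter z) id z (@cvg_id _ _) _ e0'.
apply: filterS => w /= h.
rewrite -(raddfB (@complex.Re R : Rcomplex R -> R)) -ltcR.
exact: (le_lt_trans (normc_ge_Re _)) h.
Qed.

Lemma continuous_Re_lincomb L : continuous (fun q : W => 'Re (lincomb L q) : C).
Proof.
have cL : continuous (fun q : W => lincomb L q).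
  apply: cfun_sum => u; apply: cfunM; first exact: cfun_cst.
  exact: continuous_eval.
rewrite (_ : (fun x => _) = fun q : W =>
    2^-1 * (lincomb L q + (lincomb L q)^*)); last first.
  by apply/funext => q; rewrite ReE mulrC.
by apply: cfunM; [exact: cfun_cst|exact: cfunD cL (cfun_conj cL)].
Qed.

Definition states : set W := [set q | q 0 = 1 /\ posdef q].

Lemma compact_states : compact states.
Proof.
have cl : closed states.
  rewrite (_ : states = [set q : W | q 0 = 1] `&` [set q : W | posdef q]) //.
  apply: closedI.
    by apply: closed_eqf; [exact: continuous_eval|exact: cfun_cst].
  apply: closed_forall => s; apply: closed_gef.
  apply: cfun_sum => u; apply: cfun_sum => v.
  by apply: cfunM; [exact: cfun_cst|exact: continuous_eval].
apply: (subclosed_compact cl (@compact_bounded_functions R X (fun=> 1))).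
by move=> q [q0 pq] x; rewrite -q0; exact: posdef_norm.
Qed.

Lemma compact_circle_homs : compact [set th : W | circle_hom th].
Proof.
apply: subclosed_compact (@compact_bounded_functions R X (fun=> 1)) _; last first.
  by move=> th [_ th1] x; rewrite th1.
rewrite (_ : [set th | _] = [set th : W | forall x y, th (x + y) = th x * th y] `&`
  [set th : W | forall x, `|th x| = 1])//.
apply: closedI; apply: closed_forall => x; last first.
  by apply: closed_eqf; [apply: cfun_norm; exact: continuous_eval|exact: cfun_cst].
apply: closed_forall => y; apply: closed_eqf; first exact: continuous_eval.
by apply: cfunM; exact: continuous_eval.
Qed.

Section Maximum.
Variables (p : W) (L : seq (X * C)) (F : seq X) (e : C).
Hypotheses (sp : states p) (e0 : 0 < e).

(** [Psi] adds a strictly convex function of the values on F to a linear term. The squares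
    contribute between 0 and [size F] on states, so with this weight a maximiser of [Psi] loses at
    most e in the linear term. *)
Let b : C := (size F).+1%:R / e.
Let b_ge0 : 0 <= b. Proof. by rewrite divr_ge0// ltW. Qed.

Let Psi q : C := b * 'Re (lincomb L q) + \sum_(y <- F) `|q y| ^+ 2.

Let Psi_real q : Psi q \is Num.real.
Proof.
rewrite rpredD ?rpred_sum// => [|y _].
  by apply: realM; [exact: ger0_real|exact: Creal_Re].
by rewrite rpredX ?normr_real.
Qed.

Let exists_max : exists2 q, states q & forall q', states q' -> Psi q' <= Psi q.
Proof.
have cPsi : continuous (Psi : W -> C).
  apply: cfunD; last first.
    apply: cfun_sum => y; rewrite /= (_ : (fun x => _) = fun q : W => `|q y| * `|q y|).
      by apply: cfunM; apply: cfun_norm; exact: continuous_eval.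
    by apply/funext => q; rewrite expr2.
  apply: cfunM; first exact: cfun_cst.
  exact: continuous_Re_lincomb.
have cf : continuous (fun q : W => complex.Re (Psi q)).
  by move=> q; apply: continuous_comp; [exact: cPsi|exact: continuous_Re].
have [|q /set_mem sq qmax] := compact_EVT_max _ compact_states (continuous_subspaceT cf).
  by exists p.
exists q => // q' sq'; rewrite -(RRe_real (Psi_real q')) -(RRe_real (Psi_real q)) lecR.
by apply: qmax; exact/mem_set.
Qed.

(** A maximiser q behaves like an extreme point of the states. For |c| = 1 let d be the symmetrised
    translate of q and g = d(0). Then q + d and q - d are positive definite with values 1 + g and 1
    - g at 0, so q is a convex combination of their normalisations. Strict convexity of [Psi] forces
    d = g q on F, and c = 1, 'i together give multiplicativity. *)
Lemma state_partially_multiplicative : exists2 q, states q &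
  'Re (lincomb L p) - e <= 'Re (lincomb L q) /\
  (forall x y, y \in F -> q (y + x) = q x * q y).
Proof.
have [q [q1 pq] qmax] := exists_max.
(* Maximality of q for the state r / r 0, multiplied by r 0 ^+ 2 so as to cover r 0 = 0 too. *)
have Psi_hom r : posdef r ->
    r 0 * b * 'Re (lincomb L r) + \sum_(y <- F) `|r y| ^+ 2 <= r 0 ^+ 2 * Psi q.
  move=> pr; have := posdef_ge0 pr; rewrite le_eqVlt => /predU1P[r0|r0].
    have rE y : r y = 0.
      by apply/eqP; rewrite -normr_eq0 eq_le normr_ge0 andbT r0 posdef_norm.
    rewrite -r0 !mul0r add0r expr0n/= mul0r big1// => y _.
    by rewrite rE normr0 expr0n.
  have rr : r 0 \is Num.real by rewrite gtr0_real.
  have : states (fun x => (r 0)^-1 * r x).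
    by split; [rewrite mulVf// gt_eqF|apply: posdefZ => //; rewrite invr_ge0 ltW].
  move=> /qmax; rewrite -(ler_pM2l (exprn_gt0 2 r0)); apply: le_trans.
  rewrite /Psi lincombZ ReMl ?rpredV// mulrDr mulr_sumr le_eqVlt; apply/orP; left.
  apply/eqP; congr (_ + _).
    by field; rewrite gt_eqF.
  apply: eq_bigr => y _; rewrite normrM normfV (gtr0_norm r0).
  by field; rewrite gt_eqF.
have key c x y : `|c| = 1 -> y \in F ->
    (c * q (y + x) + c^* * q (y - x)) / 2 = 'Re (c * q x) * q y.
  move=> nc yF; pose g := 'Re (c * q x).
  pose d z := (c * q (z + x) + c^* * q (z - x)) / 2.
  have gr : g^* = g by apply/CrealP/Creal_Re.
  have d0 : d 0 = g by rewrite /d add0r sub0r (posdef_conj _ pq) -rmorphM/= /g ReE.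
  pose r1 z := q z + d z; pose r2 z := q z - d z.
  have pr1 : posdef r1 by exact: posdef_twist.
  have pr2 : posdef r2.
    rewrite (_ : r2 = twist q x (- c)); last first.
      by apply/funext => z; rewrite /r2 /twist /d rmorphN/=; field.
    by apply: posdef_twist; rewrite ?normrN.
  have g1 : 0 <= 1 + g by rewrite -d0 -q1; exact: (posdef_ge0 pr1).
  have g2 : 0 <= 1 - g by rewrite -d0 -q1; exact: (posdef_ge0 pr2).
  have Lr1 : lincomb L r1 = lincomb L q + lincomb L d by exact: lincombD.
  have Lr2 : lincomb L r2 = lincomb L q - lincomb L d.
    rewrite -mulN1r -lincombZ -lincombD; congr lincomb.
    by apply/funext => z; rewrite mulN1r.
  (* The crossed weights 1 - g and 1 + g cancel the linear terms; what remains is -2 times a sum of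
     squares |d - g q|^2. *)
  have := lerD (ler_wpM2l g2 (Psi_hom _ pr1)) (ler_wpM2l g1 (Psi_hom _ pr2)).
  have r10 : r1 0 = 1 + g by rewrite -d0 -q1.
  have r20 : r2 0 = 1 - g by rewrite -d0 -q1.
  rewrite r10 r20 -subr_ge0.
  set lhs := (X in 0 <= X).
  have -> : lhs = - (2 * \sum_(z <- F) `|d z - g * q z| ^+ 2).
    rewrite /lhs /Psi Lr1 Lr2 !raddfB/= !raddfD/=.
    set A := 'Re _; set D := 'Re _.
    transitivity (2 * (1 - g ^+ 2) * \sum_(z <- F) `|q z| ^+ 2
       - ((1 - g) * \sum_(z <- F) `|r1 z| ^+ 2 + (1 + g) * \sum_(z <- F) `|r2 z| ^+ 2)).
      by ring.
    rewrite !mulr_sumr -big_split/= -sumrB -sumrN; apply: eq_bigr => z _.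
    rewrite !normCK /r1 /r2 !(rmorphB, rmorphD, rmorphM)/= gr; ring.
  rewrite oppr_ge0 pmulr_rle0// => hsum.
  have : \sum_(z <- F) `|d z - g * q z| ^+ 2 == 0.
    by rewrite eq_le hsum sumr_ge0// => z _; rewrite exprn_ge0.
  rewrite psumr_eq0 => [/allP/(_ _ yF)|z _]; last by rewrite exprn_ge0.
  by rewrite /= expf_eq0/= normr_eq0 subr_eq0 => /eqP.
exists q; first by split.
split=> [|x y yF].
  have := qmax _ sp; rewrite /Psi => h.
  have hF : \sum_(y <- F) `|q y| ^+ 2 <= (size F)%:R.
    rewrite -sum1_size natr_sum ler_sum// => y _.
    by rewrite exprn_ile1// -q1 posdef_norm.
  have {}h : b * 'Re (lincomb L p) <= b * 'Re (lincomb L q) + (size F)%:R.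
    rewrite (le_trans _ (lerD (lexx _) hF))// (le_trans _ h)// lerDl.
    by rewrite sumr_ge0// => y _; rewrite exprn_ge0.
  have bgt0 : 0 < b by rewrite divr_gt0.
  rewrite -(ler_pM2l bgt0) mulrBr lerBlDr (le_trans h)// lerD2l.
  by rewrite /b divfK ?gt_eqF// ler_nat.
have h1 := key 1 x y (normr1 _) yF.
have hi := key 'i x y (normCi _) yF.
move: h1 hi; rewrite rmorph1 !mul1r conjCi mulrC !ReMil.
move=> h1 hi.
have -> : q (y + x) = (2^-1 * (q (y + x) + q (y - x))) -
   'i * (('i * q (y + x) + - 'i * q (y - x)) / 2).
  have -> : 'i * (('i * q (y + x) + - 'i * q (y - x)) / 2) =
    ('i * 'i) * ((q (y + x) - q (y - x)) / 2) by ring.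
  by rewrite mulCii; field.
by rewrite h1 hi [in RHS](Crect (q x)); ring.
Qed.

End Maximum.

(* A weak form of Bochner's theorem: a positive definite function is, up to   *)
(* closure, a convex combination of characters of the discrete group X.       *)
Lemma circle_hom_dominates (p : X -> C) L (e : C) :
  p 0 = 1 -> posdef p -> 0 < e ->
  exists2 th, circle_hom th & 'Re (lincomb L p) - e <= 'Re (lincomb L th).
Proof.
move=> p1 pp e0.
pose P (y : X) : set W := [set q : W | forall x, q (y + x) = q x * q y].
have clP y : closed (P y).
  apply: closed_forall => x; apply: closed_eqf; first exact: continuous_eval.
  by apply: cfunM; exact: continuous_eval.
have clL : closed [set q : W | 0 <= 'Re (lincomb L q) - ('Re (lincomb L p) - e)].
  apply: closed_gef; apply: cfunB; last exact: cfun_cst.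
  exact: continuous_Re_lincomb.
have [F|q [[q1 pq] Lq] hq] := compact_fip (compact_closedI compact_states clL) clP.
  have [q sq [Lq hq]] := state_partially_multiplicative L F (conj p1 pp : states p) e0.
  by exists q; [split=> //=; rewrite subr_ge0|move=> y yF x; exact: hq].
exists q; last by rewrite -subr_ge0.
split=> [x y|x]; first by rewrite hq mulrC.
have h z : `|q z| <= 1 by rewrite -q1 posdef_norm.
apply/eqP; rewrite eq_le h/=.
have : `|q x| * `|q (- x)| = 1 by rewrite -normrM mulrC -hq subrr q1 normr1.
by move=> <-; rewrite ler_piMr.
Qed.

End BochnerWeak.

(** * Almost periodic functions *)

Section MeanTheory.
Variables (R : realType) (X : zmodType).
Local Notation C := R[i]^o.
Variable M : (X -> C) -> C.
Hypothesis meanM : is_mean M.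
Implicit Types f g : X -> C.

Lemma mean_cst c : M (fun=> c) = c.
Proof.
rewrite -[RHS]mulr1 -(mean1 meanM) -(meanZ meanM c (bdd_cst X 1)).
by congr M; apply/funext => x; rewrite mulr1.
Qed.

Lemma meanB f g : bdd f -> bdd g -> M (fun x => f x - g x) = M f - M g.
Proof.
move=> bf bg; rewrite -mulN1r -(meanZ meanM _ bg) -(meanD meanM) //.
  by congr M; apply/funext => x; rewrite mulN1r.
by apply: bddM => //; exact: bdd_cst.
Qed.

Lemma mean_le f g : bdd f -> bdd g -> (forall x, f x <= g x) -> M f <= M g.
Proof.
move=> bf bg fg; rewrite -subr_ge0 -meanB//; apply: (mean_ge0 meanM).
  by apply: bddD => //; exact: bddN.
by move=> x; rewrite subr_ge0.
Qed.

Lemma mean_sum (I : Type) (r : seq I) (F : I -> X -> C) :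
  (forall i, bdd (F i)) ->
  M (fun x => \sum_(i <- r) F i x) = \sum_(i <- r) M (F i).
Proof.
move=> bF; elim: r => [|i r IH].
  by rewrite big_nil -[RHS](mean_cst 0); congr M; apply/funext => x; rewrite big_nil.
rewrite big_cons -IH -(meanD meanM)//; last exact: bdd_sum.
by congr M; apply/funext => x; rewrite big_cons.
Qed.

End MeanTheory.

(** * Cauchy-Schwarz estimates for finite sums *)

Section SquareSums.
Variable R : realType.
Local Notation C := R[i]^o.

Lemma norm_sum_sqr (I : Type) (s : seq I) (z : I -> C) :
  `|\sum_(i <- s) z i| ^+ 2 <= (size s)%:R * \sum_(i <- s) `|z i| ^+ 2.
Proof.
apply: (@le_trans _ _ ((\sum_(i <- s) `|z i|) ^+ 2)).
  by rewrite lerXn2r ?nnegrE// ?ler_norm_sum// sumr_ge0.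
(* The expanded sum of the squares (a - |z i|)^2; at a = |z i| for the new index it is the increment
   in the induction. *)
have quad (a : C) (t : seq I) : a \is Num.real ->
    0 <= (size t)%:R * a ^+ 2 - 2 * a * \sum_(i <- t) `|z i| + \sum_(i <- t) `|z i| ^+ 2.
  move=> ar; elim: t => [|i t IH]; first by rewrite !big_nil mul0r mulr0 subrr addr0.
  have := addr_ge0 IH (_ : 0 <= (a - `|z i|) ^+ 2).
  rewrite real_exprn_even_ge0 ?realB// => /(_ isT).
  by rewrite !big_cons/= -natr1; congr (0 <= _); ring.
elim: s => [|i s IH]; first by rewrite !big_nil expr0n/= mul0r.
rewrite -subr_ge0 in IH; rewrite -subr_ge0.
have := addr_ge0 (quad `|z i| s (normr_real _)) IH.
by rewrite !big_cons/= -natr1; congr (0 <= _); ring.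
Qed.

(** Cauchy-Schwarz for the class sizes: they add up to [size s], and their squares add up to the
    number of pairs in a common class. *)
Lemma pigeonhole_pairs (T : Type) K (cls : T -> 'I_K.+1) (s : seq T) :
  (size s)%:R ^+ 2 <=
  K.+1%:R * \sum_(c <- s) \sum_(d <- s) (cls c == cls d)%:R :> C.
Proof.
pose z (i : 'I_K.+1) : C := \sum_(c <- s) (cls c == i)%:R.
have sumz : \sum_(i <- enum 'I_K.+1) z i = (size s)%:R.
  rewrite exchange_big -sum1_size natr_sum; apply: eq_bigr => c _.
  by rewrite big_enum (bigD1 (cls c))//= eqxx big1 ?addr0// => i; rewrite eq_sym => /negPf ->.
have := norm_sum_sqr (enum 'I_K.+1) z; rewrite sumz size_enum_ord normr_nat.
congr (_ <= _ * _); rewrite big_enum.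
transitivity (\sum_i \sum_(c <- s) \sum_(d <- s) (cls c == i)%:R * (cls d == i)%:R : C).
  apply: eq_bigr => i _; have zr : z i \is Num.real by apply: rpred_sum => c _; rewrite ger0_real.
  rewrite real_normK// expr2 mulr_suml; apply: eq_bigr => c _.
  by rewrite mulr_sumr.
rewrite exchange_big; apply: eq_bigr => c _.
rewrite exchange_big; apply: eq_bigr => d _.
rewrite (bigD1 (cls c))//= eqxx mul1r eq_sym big1 ?addr0// => i.
by rewrite eq_sym => /negPf ->; rewrite mul0r.
Qed.

End SquareSums.

Section AlmostPeriodic.
Variables (R : realType) (X : zmodType).
Local Notation C := R[i]^o.
Local Notation W := (prod_topology (fun _ : X => C)).
Variable M : (X -> C) -> C.
Hypothesis meanM : is_mean M.
Variable g : X -> C.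
Hypotheses (bg : bdd g) (rg : forall x, (g x)^* = g x).

Definition autocorrelation x := M (fun y => g (y + x) * g y).
Local Notation h := autocorrelation.

(** Growth like the square of [size s] means that th occurs as a frequency of g. *)
Definition energy (th : X -> C) (s : seq X) :=
  M (fun y => `|\sum_(c <- s) (th c)^* * g (y + c)| ^+ 2).

Let bgg a b : bdd (fun y => g (y + a) * g (y + b)).
Proof. by apply: bddM; exact: bdd_shift. Qed.

Lemma autocorrelationB c d : M (fun y => g (y + c) * g (y + d)) = h (c - d).
Proof.
rewrite -(mean_shift meanM (- d) (bgg c d)); congr M; apply/funext => y.
by rewrite subrK -addrA [- d + c]addrC.
Qed.

Lemma mean_sqr_shifts (I : Type) (w : I -> C) (a : I -> X) (s : seq I) :
  M (fun y => `|\sum_(i <- s) w i * g (y + a i)| ^+ 2) =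
  \sum_(i <- s) \sum_(j <- s) w i * (w j)^* * h (a i - a j).
Proof.
transitivity (M (fun y => \sum_(i <- s) \sum_(j <- s)
    (w i * (w j)^*) * (g (y + a i) * g (y + a j)))).
  congr M; apply/funext => y; rewrite normCK rmorph_sum/= mulr_suml.
  apply: eq_bigr => i _; rewrite mulr_sumr; apply: eq_bigr => j _.
  by rewrite rmorphM/= rg; ring.
have bF i j : bdd (fun y => (w i * (w j)^*) * (g (y + a i) * g (y + a j))).
  by apply: bddM => //; exact: bdd_cst.
rewrite (mean_sum meanM) => [|i]; last exact: bdd_sum.
apply: eq_bigr => i _; rewrite (mean_sum meanM)//; apply: eq_bigr => j _.
by rewrite (meanZ meanM)// autocorrelationB.
Qed.

Lemma bdd_shift_sum (I : Type) (w : I -> C) (a : I -> X) (s : seq I) :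
  bdd (fun y => \sum_(i <- s) w i * g (y + a i)).
Proof.
by apply: bdd_sum => u _; apply: bddM; [exact: bdd_cst|exact: bdd_shift].
Qed.

Lemma posdef_autocorrelation : posdef h.
Proof.
move=> s; have <- : M (fun y => `|\sum_(u <- s) u.2 * g (y + u.1)| ^+ 2) = hermitian_sum h s.
  exact: mean_sqr_shifts.
apply: (mean_ge0 meanM) => [|y]; last exact: exprn_ge0.
by apply: bddX; apply: bdd_norm; exact: bdd_shift_sum.
Qed.

Lemma energy_ge0 th s : 0 <= energy th s.
Proof.
apply: (mean_ge0 meanM) => [|y]; last exact: exprn_ge0.
by apply: bddX; apply: bdd_norm; exact: bdd_shift_sum.
Qed.

Lemma energyE th s : energy th s =
  \sum_(c <- s) \sum_(d <- s) (th c)^* * th d * h (c - d).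
Proof.
rewrite [LHS]mean_sqr_shifts.
by apply: eq_bigr => c _; apply: eq_bigr => d _; rewrite conjCK.
Qed.

(** The sum over s + t is a twisted sum of translates of the sum over s, so Cauchy-Schwarz and
    invariance of the mean apply. Hence a lower energy bound for s + t passes to s, and one sumset
    can serve finitely many lists. *)
Lemma energy_sumset th s t : circle_hom th ->
  energy th [seq c + d | c <- s, d <- t] <= (size t)%:R ^+ 2 * energy th s.
Proof.
move=> [thD th1].
pose U y := \sum_(c <- s) (th c)^* * g (y + c).
have bU : bdd U by exact: bdd_shift_sum.
have bU2 d : bdd (fun y => `|(th d)^* * U (y + d)| ^+ 2).
  by apply: bddX; apply: bdd_norm; apply: bddM; [exact: bdd_cst|exact: bdd_shift].
have -> : energy th [seq c + d | c <- s, d <- t] =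
    M (fun y => `|\sum_(d <- t) (th d)^* * U (y + d)| ^+ 2).
  congr M; apply/funext => y; congr (`|_| ^+ 2).
  rewrite big_allpairs_dep/= exchange_big; apply: eq_bigr => d _.
  rewrite mulr_sumr; apply: eq_bigr => c _.
  by rewrite thD rmorphM/= -addrA [d + c]addrC; ring.
apply: (@le_trans _ _ (M (fun y => (size t)%:R * \sum_(d <- t) `|(th d)^* * U (y + d)| ^+ 2))).
  apply: (mean_le meanM) => [||y]; last exact: norm_sum_sqr.
    apply: bddX; apply: bdd_norm; apply: bdd_sum => d _.
    by apply: bddM; [exact: bdd_cst|exact: bdd_shift].
  by apply: bddM; [exact: bdd_cst|exact: bdd_sum].
rewrite (meanZ meanM); last exact: bdd_sum.
rewrite (mean_sum meanM)// expr2 -mulrA ler_wpM2l// le_eqVlt; apply/orP; left; apply/eqP.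
rewrite -sum1_size natr_sum mulr_suml; apply: eq_bigr => d _; rewrite mul1r.
rewrite -[RHS](mean_shift meanM d); last by apply: bddX; exact: bdd_norm.
by congr M; apply/funext => y; rewrite normrM norm_conjC th1 mul1r.
Qed.

(* The last hypothesis expresses that g is almost periodic: finitely many     *)
(* classes of translates of g.                                                *)
Lemma exists_energetic_hom K (cls : X -> 'I_K.+1) :
  0 < h 0 -> (forall c d, cls c = cls d -> h 0 / 2 <= h (c - d)) ->
  exists2 th, circle_hom th &
    exists2 r : C, 0 < r & forall s, r * (size s)%:R ^+ 2 <= energy th s.
Proof.
(* Pairs in a common class give a lower bound 2 r |s|^2 for the test value of h / h 0; the weak
   Bochner theorem is applied with error r |s|^2. *)
move=> h0 hcls; pose r : C := h 0 / (8 * K.+1%:R).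
have r0 : 0 < r by rewrite divr_gt0// mulr_gt0.
have ph := posdef_autocorrelation.
pose Q (s : seq X) : set W := [set th | 0 <= energy th s - r * (size s)%:R ^+ 2].
have cQ s : closed (Q s).
  apply: closed_gef; apply: cfunB; last exact: cfun_cst.
  rewrite (_ : (fun x => _) = fun th : W =>
    \sum_(c <- s) \sum_(d <- s) (th c)^* * th d * h (c - d)); last first.
    by apply/funext => th; rewrite energyE.
  apply: cfun_sum => c; apply: cfun_sum => d; apply: cfunM; last exact: cfun_cst.
  by apply: cfunM; [apply: cfun_conj|]; exact: continuous_eval.
have one (s : seq X) : s != [::] -> exists2 th, circle_hom th & Q s th.
  move=> sn; have ss0 : 0 < (size s)%:R :> C by rewrite ltr0n lt0n size_eq0.
  pose L := [seq (d - c, h (c - d)) | c <- s, d <- s].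
  have LE (th : X -> C) : lincomb L th = \sum_(c <- s) \sum_(d <- s) h (c - d) * th (d - c).
    by rewrite /lincomb big_allpairs_dep.
  pose p x := (h 0)^-1 * h x.
  have p1 : p 0 = 1 by rewrite /p mulVf// gt_eqF.
  have pp : posdef p by apply: posdefZ => //; rewrite invr_ge0 ltW.
  have e0 : 0 < r * (size s)%:R ^+ 2 by rewrite mulr_gt0// exprn_gt0.
  have [th hth] := circle_hom_dominates L p1 pp e0.
  have energy_real : energy th s \is Num.real by exact: ger0_real (energy_ge0 _ _).
  have <- : energy th s = lincomb L th.
    rewrite energyE LE; apply: eq_bigr => c _; apply: eq_bigr => d _.
    by rewrite hth.1 circle_homN//; ring.
  rewrite (Creal_ReP _ energy_real) => hle.
  exists th => //; rewrite /Q/= subr_ge0 (le_trans _ hle)// lerBrDl.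
  pose N : C := \sum_(c <- s) \sum_(d <- s) (cls c == cls d)%:R.
  have hN : (size s)%:R ^+ 2 <= K.+1%:R * N by exact: pigeonhole_pairs.
  have -> : lincomb L p = \sum_(c <- s) \sum_(d <- s) `|h (c - d)| ^+ 2 / h 0.
    rewrite LE; apply: eq_bigr => c _; apply: eq_bigr => d _.
    by rewrite /p -[d - c]opprB (posdef_conj _ ph) normCK; ring.
  have hr : h 0 / 4 * N <= \sum_(c <- s) \sum_(d <- s) `|h (c - d)| ^+ 2 / h 0.
    rewrite mulr_sumr ler_sum// => c _; rewrite mulr_sumr ler_sum// => d _.
    case: eqP => [/hcls hcd|_]; last by rewrite mulr0 divr_ge0 ?exprn_ge0// ltW.
    rewrite mulr1 ler_pdivlMr// (@le_trans _ _ ((h 0 / 2) ^+ 2))//.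
      by rewrite le_eqVlt; apply/orP; left; apply/eqP; field.
    have hcd0 : 0 <= h (c - d) by rewrite (le_trans _ hcd)// divr_ge0// ltW.
    by rewrite lerXn2r ?nnegrE ?divr_ge0 ?(ltW h0)// ger0_norm.
  rewrite (Creal_ReP _ (ger0_real (le_trans _ hr))); last first.
    by rewrite mulr_ge0 ?divr_ge0 ?(ltW h0)// !sumr_ge0// => *; rewrite sumr_ge0.
  rewrite (le_trans _ hr)// -mulr2n -mulrnAl.
  have -> : r *+ 2 = h 0 / 4 / K.+1%:R.
    by rewrite /r; field; rewrite ?nat1r ?natr1 pnatr_eq0.
  by rewrite -[h 0 / 4 / _ * _]mulrA ler_pM2l ?divr_gt0// ler_pdivrMl.
have sumset (S : seq (seq X)) : exists2 t, t != [::] &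
    forall th, circle_hom th -> Q t th -> forall s, s \in S -> s != [::] -> Q s th.
  elim: S => [|s S [t tn ht]]; first by exists [:: 0].
  have [sn|sn] := eqVneq s [::].
    exists t => // th hth Qt s'; rewrite inE => /predU1P[->|]; first by rewrite sn.
    exact: ht.
  have sub (u v : seq X) th : circle_hom th -> v != [::] ->
      Q [seq c + d | c <- u, d <- v] th -> Q u th.
    move=> hth vn; have v0 : 0 < (size v)%:R :> C by rewrite ltr0n lt0n size_eq0.
    rewrite /Q/= !subr_ge0 size_allpairs natrM exprMn => /le_trans.
    move=> /(_ _ (energy_sumset u v hth)).
    by rewrite mulrCA [X in X <= _]mulrC mulrAC mulrC ler_pM2l ?exprn_gt0// mulrC.
  exists [seq c + d | c <- s, d <- t].
    by rewrite -size_eq0 size_allpairs muln_eq0 !size_eq0 negb_or sn.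
  move=> th hth Qst s'; rewrite inE => /predU1P[-> _|]; first exact: sub Qst.
  apply: ht => //; apply: (sub _ s) => //.
  move: Qst; rewrite /Q/= !size_allpairs mulnC; congr (0 <= M _ - _).
  apply/funext => y; congr (`|_| ^+ 2).
  rewrite !big_allpairs_dep exchange_big/=; apply: eq_bigr => c _.
  by apply: eq_bigr => d _; rewrite addrC.
have [S|th hth hQ] := compact_fip (@compact_circle_homs R X) cQ.
  have [t tn ht] := sumset S; have [th hth Qt] := one _ tn.
  exists th => // s sS; have [->|] := eqVneq s [::]; last exact: ht.
  by rewrite /Q/= expr0n/= mulr0 subr0 energy_ge0.
by exists th => //; exists r => // s; rewrite -subr_ge0; exact: hQ.
Qed.

End AlmostPeriodic.

(** * Compact groups have enough characters *)

Section CompactGroup.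
Variables (R : realType) (X : topologicalZmodType).
Local Notation C := R[i]^o.
Hypothesis cX : compact [set: X].

Lemma translate_continuous (a : X) : continuous (fun x : X => x + a).
Proof.
move=> x; apply: (@continuous_comp _ _ _ (fun x : X => (x, a)) (fun z : X * X => z.1 + z.2)).
  by apply: cvg_pair => /=; [exact: cvg_id|exact: cvg_cst].
exact: add_continuous.
Qed.

Lemma near_translate (P : X -> Prop) (a : X) :
  (\forall u \near (0 : X), P u) -> \forall x \near a, P (x - a).
Proof.
move=> P0; have := @translate_continuous (- a) a; rewrite /continuous_at subrr.
by move=> /(_ _ P0).
Qed.

Lemma uniformly_continuous_group (f : X -> C) (e : C) : continuous f -> 0 < e ->
  \forall u \near (0 : X), forall y, `|f (y + u) - f y| < e.
Proof.
move=> cf e0.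
have := (compact_near_coveringP _).1 cX X (nbhs (0 : X))
  (fun u y => `|f (y + u) - f y| < e) _.
move=> /(_ (nbhs_filter _)) H.
have : \forall u \near (0 : X), [set: X] `<=` (fun y => `|f (y + u) - f y| < e).
  apply: H => x _.
  pose F (z : X * X) : C := f (z.1 + z.2) - f z.1.
  have cF : continuous F.
    apply: cfunB => z.
      by apply: continuous_comp; [exact: add_continuous|exact: cf].
    by apply: continuous_comp; [exact: cvg_fst|exact: cf].
  have := @cvgr_dist_lt _ C _ _ (nbhs_filter _) F _ (cF (x, 0)) _ e0.
  apply: filterS => -[y u] /=.
  by rewrite /F/= addr0 subrr sub0r normrN.
by apply: filterS => u hu y; exact: hu.
Qed.

Lemma finite_translates_cover (U : set X) : nbhs 0 U ->
  exists s : seq X, forall x, exists2 z, z \in s & U (x - z).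
Proof.
move=> U0; apply: contrapT => ncov.
pose P (z : X) := [set x | ~ (U° (x - z))].
have cP z : closed (P z).
  rewrite (_ : P z = ~` ((fun x => x - z) @^-1` U°))//; apply: open_closedC.
  apply: open_comp; last exact: open_interior.
  by move=> x _; exact: translate_continuous.
have [s|x _ /(_ x)] := compact_fip cX cP; last first.
  by rewrite /P/= subrr; apply.
apply: contrapT => ns; apply: ncov; exists s => x.
apply: contrapT => nx; apply: ns; exists x => // z zs /= Uxz.
by apply: nx; exists z => //; exact: interior_subset.
Qed.

Lemma bdd_continuous (f : X -> C) : continuous f -> bdd f.
Proof.
move=> cf.
have [s hs] := finite_translates_cover (uniformly_continuous_group cf ltr01).
exists (\sum_(z <- s) (`|f z| + 1)) => x.
have [z zs /(_ z)] := hs x; rewrite [z + _]addrC subrK => hz.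
have h t : 0 <= `|f t| + 1 by rewrite addr_ge0.
rewrite (perm_big _ (perm_to_rem zs)) big_cons /= ler_wpDr ?sumr_ge0//.
rewrite -[f x](subrK (f z)) (le_trans (ler_normD _ _))// addrC lerD2l.
exact: ltW.
Qed.

Variable M : (X -> C) -> C.
Hypothesis meanM : is_mean M.

(** Finitely many translates of U cover X, so the sum of as many translates of f is at least c
    everywhere. This replaces positivity of Haar measure on open sets; k depends on U alone. *)
Lemma mean_syndetic (U : set X) : nbhs 0 U -> exists k : nat,
  forall (f : X -> C) (c : C), bdd f -> (forall x, 0 <= f x) ->
  (forall x, U x -> c <= f x) -> c <= k%:R * M f.
Proof.
move=> /finite_translates_cover[s hs]; exists (size s) => f c bf f0 hc.
have -> : (size s)%:R * M f = M (fun x => \sum_(z <- s) f (x - z)).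
  rewrite (mean_sum meanM) => [|z]; last exact: bdd_shift.
  rewrite -sum1_size natr_sum mulr_suml; apply: eq_bigr => z _.
  by rewrite mul1r (mean_shift meanM).
rewrite -[X in X <= _](mean_cst meanM); apply: (mean_le meanM) => [||x].
- exact: bdd_cst.
- by apply: bdd_sum => z _; exact: bdd_shift.
have [z zs Uxz] := hs x.
rewrite (perm_big _ (perm_to_rem zs)) big_cons /= ler_wpDr ?sumr_ge0//.
exact: hc.
Qed.

End CompactGroup.

(** * Continuous characters separate points *)

Section Separation.
Variables (R : realType) (X : topologicalZmodType).
Local Notation C := R[i]^o.
Hypothesis cX : compact [set: X].

Lemma dual_of_circle_hom (th : X -> C) : circle_hom th ->
  (forall e : C, 0 < e -> \forall u \near (0 : X), `|th u - 1| < e) ->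
  exists a : dual R X, forall x, a x = th x.
Proof.
move=> hth th_cont; have [thD th1] := hth.
suff cth : continuous th by exists (Character th1 thD cth).
move=> x; apply/(@cvgrPdist_lt _ C _ _ (nbhs_filter x)) => e e0.
apply: filterS (near_translate x (th_cont _ e0)) => y.
have -> : th x - th y = - (th x * (th (y - x) - 1)).
  by rewrite mulrBr -thD [x + _]addrC subrK mulr1 opprB.
by rewrite normrN normrM th1 mul1r.
Qed.

(** The function g = f(. + x0) - f is nonzero and, X being compact, almost periodic; let th be a
    homomorphism with large energy. If th(x0) = 1, the sums of g along multiples of x0 would
    telescope and stay bounded. If x is near 0, the sums along multiples of x are almost invariant
    under x, which forces th(x) to be near 1; so th is continuous. *)
Lemma dual_separates (f : X -> C) (x0 : X) :
  continuous f -> (forall x, (f x)^* = f x) -> f x0 != f 0 ->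
  exists a : dual R X, a x0 != 1.
Proof.
move=> cf rf fx0.
have [M meanM] := mean_exists R X.
pose g y := f (y + x0) - f y.
have cg : continuous g.
  apply: cfunB; last exact: cf.
  by move=> y; exact: (continuous_comp (@translate_continuous X x0 y) (cf _)).
have rg x : (g x)^* = g x by rewrite rmorphB/= !rf.
have g0 : g 0 != 0 by rewrite /g add0r subr_eq0.
have bg : bdd g := bdd_continuous cX cg.
have [B gB] := bg.
have B0 : 0 < B.
  by rewrite (lt_le_trans _ (gB 0))// normr_gt0.
pose h := autocorrelation M g.
have h0 : 0 < h 0.
  pose c := `|g 0| / 2.
  have c0 : 0 < c by rewrite divr_gt0// normr_gt0.
  have [k hk] := mean_syndetic cX meanM (uniformly_continuous_group cX cg c0).
  have := hk (fun y => g y * g y) (c ^+ 2).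
  have sqr x : g x * g x = `|g x| ^+ 2 by rewrite normCK rg.
  have -> : M (fun y => g y * g y) = h 0.
    by congr M; apply/funext => y; rewrite addr0.
  move=> hk2; have : c ^+ 2 <= k%:R * h 0.
    apply: hk2 => [|x|x]; first exact: bddM.
      by rewrite sqr exprn_ge0.
    move=> /(_ 0); rewrite add0r => /ltW gx; rewrite sqr lerXn2r ?nnegrE ?(ltW c0) ?normr_ge0//.
    have : `|g 0| <= `|g x| + `|g x - g 0|.
      by rewrite -[X in `|X| <= _](subKr (g x)) ler_normB.
    rewrite -lerBlDr => hle. apply: le_trans hle.
    rewrite lerBrDr (le_trans (lerD (lexx _) gx))//.
    by rewrite /c -splitr.
  move=> /(lt_le_trans (exprn_gt0 2 c0)) hk3.
  have h0 : 0 <= h 0 by exact: posdef_ge0 (posdef_autocorrelation meanM bg rg).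
  rewrite lt_def h0 andbT; apply: contraTneq hk3 => ->.
  by rewrite mulr0 ltxx.
(* Translates in one class differ by less than 2 e, and 2 e B = h 0 / 2 is the allowed loss in the
   autocorrelation. *)
pose e := h 0 / (4 * B).
have e0 : 0 < e by rewrite divr_gt0// mulr_gt0.
have [s hs] := finite_translates_cover cX (uniformly_continuous_group cX cg e0).
pose near_ z x := `[< forall y, `|g (y + (x - z)) - g y| < e >].
have [K sK] : exists K, size s = K.+1.
  by have [z zs _] := hs 0; case: s zs {hs} => // a s' _; exists (size s').
have hasx x : has (near_^~ x) s.
  by have [z zs hz] := hs x; apply/hasP; exists z => //; apply/asboolP.
pose cls x : 'I_K.+1 := inord (find (near_^~ x) s).
have clsP x : near_ (nth 0 s (cls x)) x.
  rewrite inordK; first exact: (nth_find 0 (hasx x)).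
  by rewrite -sK -has_find.
have hcls c d : cls c = cls d -> h 0 / 2 <= h (c - d).
  move=> cd; set z := nth 0 s (cls c).
  have hc y : `|g (y + c) - g (y + z)| < e.
    have /asboolP/(_ (y + z)) := clsP c.
    by rewrite -/z -[y + z + _]addrA [z + _]addrC subrK.
  have hd y : `|g (y + d) - g (y + z)| < e.
    have := clsP d; rewrite -cd => /asboolP/(_ (y + z)).
    by rewrite -/z -[y + z + _]addrA [z + _]addrC subrK.
  rewrite /h -(autocorrelationB meanM bg).
  have -> : h 0 / 2 = h 0 - 2 * e * B.
    by rewrite /e; field; rewrite gt_eqF.
  have -> : h 0 = M (fun y => g (y + d) * g (y + d)).
    by rewrite (autocorrelationB meanM bg) subrr.
  rewrite -[X in _ - X](mean_cst meanM).
  have bgg a b : bdd (fun y => g (y + a) * g (y + b)).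
    by apply: bddM; exact: bdd_shift.
  rewrite -(meanB meanM (bgg _ _) (bdd_cst _ _)); apply: (mean_le meanM) => // [|y].
    by apply: bddD => //; exact: bdd_cst.
  rewrite lerBlDr -lerBlDl -mulrBl.
  apply: (@le_trans _ _ `|(g (y + d) - g (y + c)) * g (y + d)|).
    by apply: real_ler_norm; rewrite CrealE rmorphM rmorphB/= !rg.
  rewrite normrM ler_pM// mulr_natl mulr2n.
  rewrite -[X in `|X|](subrKA (g (y + z))) (le_trans (ler_normD _ _))// lerD//.
    exact: ltW.
  by rewrite distrC ltW.
have [th hth [r r0 hr]] := exists_energetic_hom meanM bg rg h0 hcls.
have [thD th1] := hth.
have energy_bound s' (A D : C) : 0 <= D -> (forall y, D * `|\sum_(c <- s') (th c)^* * g (y + c)| <= A) ->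
    D ^+ 2 * (r * (size s')%:R ^+ 2) <= A ^+ 2.
  move=> D0 hA; apply: (le_trans (ler_wpM2l (exprn_ge0 2 D0) (hr s'))).
  have bE : bdd (fun y => `|\sum_(c <- s') (th c)^* * g (y + c)| ^+ 2).
    by apply: bddX; apply: bdd_norm; exact: bdd_shift_sum.
  rewrite -(meanZ meanM _ bE) -[X in _ <= X](mean_cst meanM).
  apply: (mean_le meanM) => [||y].
  - by apply: bddM => //; exact: bdd_cst.
  - exact: bdd_cst.
  by rewrite -exprMn lerXn2r ?nnegrE ?(le_trans _ (hA y)) ?mulr_ge0.
have thMn x j : th (x *+ j) = th x ^+ j.
  by elim: j => [|j IH]; rewrite ?mulr0n ?circle_hom0// mulrS thD IH exprS.
have thx0 : th x0 != 1.
  apply/eqP => th0; have [A fA] := bdd_continuous cX cf.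
  have A0 : 0 <= A := le_trans (normr_ge0 _) (fA 0).
  suff : r = 0 by move=> r00; rewrite r00 ltxx in r0.
  apply: (@complex_archimedean R _ ((2 * A) ^+ 2) (ltW r0)) => N.
  have := @energy_bound [seq x0 *+ j | j <- iota 0 N.+1] (2 * A) 1 ler01.
  rewrite expr1n mul1r size_map size_iota => hle.
  apply: le_trans (hle _) => [|y].
    by rewrite ler_pM2l// expr2 ler_peMl// ler1n.
  rewrite mul1r big_map.
  have -> : \sum_(j <- iota 0 N.+1) (th (x0 *+ j))^* * g (y + x0 *+ j) =
      f (y + x0 *+ N.+1) - f y.
    rewrite -[iota 0 _]/(index_iota 0 N.+1).
    rewrite (telescope_sumr_eq (fun j => f (y + x0 *+ j))) ?mulr0n ?addr0// => j _.
    by rewrite thMn th0 expr1n rmorph1 mul1r /g -addrA mulrSr.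
  by rewrite (le_trans (ler_normB _ _))// mulr_natl mulr2n lerD.
suff cont (d : C) : 0 < d -> \forall u \near (0 : X), `|th u - 1| < d.
  by have [a ha] := dual_of_circle_hom hth cont; exists a; rewrite ha.
move=> d0; have sr0 : 0 < sqrtC r by rewrite sqrtC_gt0.
have ed0 : 0 < d / 2 * sqrtC r by rewrite mulr_gt0// divr_gt0.
apply: filterS (uniformly_continuous_group cX cg ed0) => x hx.
apply: (@le_lt_trans _ _ (d / 2)); last by rewrite ltr_pdivrMr// ltr_pMr// ltr1n.
set D := `|th x - 1|; have D0 : 0 <= D := normr_ge0 _.
set e' := d / 2 * sqrtC r in hx ed0.
(* With U the twisted sum along N + 1 multiples of x, (th x - 1) U(y) is U(y + x) - U(y) up to two
   boundary terms of size at most B. The energy bound turns this into a bound on D; letting N grow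
   gives D <= d / 2. *)
have main N : D * sqrtC r * N.+1%:R <= e' * N.+1%:R + 2 * B.
  have rhs0 : 0 <= e' * N.+1%:R + 2 * B.
    by rewrite addr_ge0// mulr_ge0// ltW.
  have lhs0 : 0 <= D * sqrtC r * N.+1%:R by rewrite !mulr_ge0// ltW.
  rewrite -(@ler_pXn2r _ 2)// ?nnegrE//.
  rewrite -mulrA !exprMn sqrtCK.
  have := @energy_bound [seq x *+ j | j <- iota 0 N.+1] (e' * N.+1%:R + 2 * B) D D0.
  rewrite size_map size_iota; apply => y.
  rewrite big_map.
  pose F y j := (th (x *+ j))^* * g (y + x *+ j).
  rewrite -/(F y _) (eq_bigr (F y))// -[iota 0 _]/(index_iota 0 N.+1) big_mkord.
  pose U y := \sum_(j < N.+1) F y j.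
  have shift : U (y + x) = th x * (U y + (F y N.+1 - F y 0%N)).
    have -> : U y + (F y N.+1 - F y 0%N) = \sum_(j < N.+1) F y j.+1.
      rewrite -(telescope_sumr (F y) (leq0n N.+1)) big_mkord -big_split/=.
      by apply: eq_bigr => j _; rewrite addrC subrK.
    rewrite mulr_sumr; apply: eq_bigr => j _; rewrite /F mulrSr thD rmorphM/= addrAC.
    have -> : th x * ((th (x *+ j))^* * (th x)^* * g (y + (x *+ j + x))) =
       (th x * (th x)^*) * ((th (x *+ j))^* * g (y + (x *+ j + x))) by ring.
    by rewrite -normCK th1 expr1n mul1r addrA.
  rewrite -normrM -/(U y).
  have -> : (th x - 1) * U y = (U (y + x) - U y) - th x * (F y N.+1 - F y 0%N).
    by rewrite shift; ring.
  have Fn z j : `|F z j| = `|g (z + x *+ j)| by rewrite normrM norm_conjC th1 mul1r.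
  rewrite (le_trans (ler_normB _ _))// lerD//.
    rewrite -sumrB (le_trans (ler_norm_sum _ _ _))//.
    rewrite mulr_natr -[X in _ *+ X](card_ord N.+1) -sumr_const ler_sum// => j _.
    rewrite -mulrBr normrM norm_conjC th1 mul1r.
    by have := hx (y + x *+ j); rewrite [y + _ + x]addrAC => /ltW.
  rewrite normrM th1 mul1r (le_trans (ler_normB _ _))// !Fn mulr_natl mulr2n.
  exact: lerD.
rewrite -(ler_pM2r sr0) -/e' -subr_le0.
have rD : D * sqrtC r - e' \is Num.real by rewrite rpredB ?ger0_real ?mulr_ge0// ltW.
rewrite real_leNgt ?real0//; apply/negP => Dpos.
have : D * sqrtC r - e' = 0.
  apply: (complex_archimedean (ltW Dpos) (b := 2 * B)) => N.
  by rewrite mulrBl lerBlDl.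
by move=> D00; rewrite D00 ltxx in Dpos.
Qed.

End Separation.

(** * Pontryagin duality *)

Section UnitNumbers.
Variable C : numClosedFieldType.
Implicit Types w z : C.

Lemma sqr_norm1DcM w z : `|w| = 1 -> `|z| = 1 ->
  `|1 + w^* * z| ^+ 2 = 2 + w^* * z + w * z^*.
Proof.
move=> w1 z1; rewrite normCK rmorphD rmorph1 rmorphM/= conjCK.
have -> : (1 + w^* * z) * (1 + w * z^*) =
  1 + w^* * z + w * z^* + (w * w^*) * (z * z^*) by ring.
by rewrite -!normCK w1 z1 expr1n; ring.
Qed.

Lemma sqr_normB_unit w z : `|w| = 1 -> `|z| = 1 ->
  `|z - w| ^+ 2 = 2 - w^* * z - w * z^*.
Proof.
move=> w1 z1; rewrite normCK rmorphB/=.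
have -> : (z - w) * (z^* - w^*) = z * z^* + w * w^* - w^* * z - w * z^* by ring.
by rewrite -!normCK w1 z1 expr1n; ring.
Qed.

End UnitNumbers.

Section Duality.
Variables (R : realType) (X : topologicalZmodType).
Local Notation C := R[i]^o.
Local Notation D := (dual R X).
Hypothesis cX : compact [set: X].

Lemma norm_char (a : D) x : `|a x| = 1.
Proof. exact: char_circle. Qed.

Lemma char0 (a : D) : a 0 = 1.
Proof.
by apply: (mulfI (char_neq0 a 0)); rewrite -charD addr0 mulr1.
Qed.

Lemma dual0E x : (0 : D) x = 1. Proof. by []. Qed.

Lemma dualDE (a b : D) x : (a + b) x = a x * b x. Proof. by []. Qed.

Lemma dualNE (a : D) x : (- a) x = (a x)^*.
Proof.
apply: (mulfI (char_neq0 a x)).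
by rewrite -dualDE subrr dual0E -normCK norm_char expr1n.
Qed.

Lemma geometric_dominates (a b k : C) :
  0 <= a -> (forall N, b ^+ N <= k * a ^+ N) -> ~ a < b.
Proof.
rewrite le_eqVlt => /predU1P[<- /(_ 1%N)|a0 hN ab].
  by rewrite !expr1 mulr0 => b0 /lt_le_trans/(_ b0); rewrite ltxx.
have [d d0 dE] : exists2 d, 0 < d & b / a = d + 1.
  by exists (b / a - 1); rewrite ?subrK// subr_gt0 ltr_pdivlMr// mul1r.
have bern N : d * N%:R + 1 <= (d + 1) ^+ N.
  elim: N => [|N IH]; first by rewrite mulr0 add0r expr0.
  have d1 : 0 <= d + 1 by rewrite addr_ge0// ltW.
  rewrite exprS (le_trans _ (ler_wpM2l d1 IH))// -subr_ge0 -[N.+1]addn1 natrD.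
  have -> : (d + 1) * (d * N%:R + 1) - (d * (N%:R + 1) + 1) = d ^+ 2 * N%:R by ring.
  by rewrite mulr_ge0// exprn_ge0// ltW.
have : d = 0.
  apply: (@complex_archimedean R d k (ltW d0)) => N.
  have hk : (d + 1) ^+ N.+1 <= k by rewrite -dE expr_div_n ler_pdivrMr// exprn_gt0.
  by rewrite (le_trans _ hk)// (le_trans _ (bern _))// lerDl.
by move=> d00; rewrite d00 ltxx in d0.
Qed.

(** Compactness of K reduces separation by all of L to finitely many characters with one common
    tolerance. *)
Lemma chars_isolate (L : set D) (K : set X) : closed K ->
  (forall x, K x -> exists2 a, L a & a x != 1) ->
  exists F : seq D, exists2 e : C, 0 < e <= 1 & (forall a, a \in F -> L a) /\
    forall x, (forall a, a \in F -> `|a x - 1| <= e) -> ~ K x.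
Proof.
move=> clK sepK; apply: contrapT => nF.
pose P (i : D * nat) : set X := [set x | L i.1 -> 0 <= i.2.+1%:R^-1 - `|i.1 x - 1|].
have cP i : closed (P i).
  apply: closed_imply => _; apply: closed_gef; apply: cfunB; first exact: cfun_cst.
  apply: cfun_norm; apply: cfunB; last exact: cfun_cst.
  exact: char_continuous.
have cK : compact K by exact: subclosed_compact clK cX _.
have [s|x Kx hx] := compact_fip cK cP; last first.
  have [a La /negP] := sepK _ Kx; apply; rewrite -subr_eq0 -normr_eq0; apply/eqP.
  apply: (@complex_archimedean R _ 1) => // N.
  by rewrite -ler_pdivlMr// mul1r -subr_ge0; exact: (hx (a, N)).
apply: contrapT => ns; apply: nF.
exists [seq i.1 | i <- s & `[< L i.1 >]], (\sum_(i <- s) i.2).+1%:R^-1.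
  by apply/andP; split; [rewrite invr_gt0|rewrite invf_le1 ?ler1n].
split=> [a|x hx Kx].
  by case/mapP => i; rewrite mem_filter => /andP[/asboolP ? _] ->.
apply: ns; exists x => // i si Li; rewrite subr_ge0.
apply: (le_trans (hx _ _)).
  by apply/mapP; exists i => //; rewrite mem_filter si andbT; apply/asboolP.
rewrite lef_pV2 ?posrE// ler_nat ltnS (perm_big _ (perm_to_rem si)) big_cons.
exact: leq_addr.
Qed.

Variable M : (X -> C) -> C.
Hypothesis meanM : is_mean M.

Lemma bdd_char (a : D) : bdd a.
Proof. by exists 1 => x; rewrite norm_char. Qed.

Lemma mean_char (a : D) : M a = (a == 0)%:R.
Proof.
have [->|a0] := eqVneq a 0; first exact: mean1 meanM.
have [x ax] : exists x, a x != 1.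
  apply: contrapT => nx; move/eqP: a0; apply; apply: dual_eq => x.
  by rewrite dual0E; apply/eqP/negPn/negP => ax; apply: nx; exists x.
have : a x * M a = M a.
  rewrite -(meanZ meanM _ (bdd_char a)) -[RHS](mean_shift meanM x (bdd_char a)).
  by congr M; apply/funext => y; rewrite charD mulrC.
move/eqP; rewrite -[X in _ == X]mul1r -subr_eq0 -mulrBl mulf_eq0 subr_eq0.
by rewrite (negPf ax) => /eqP.
Qed.

Definition charsum (th : D -> C) (L : seq D) x : C :=
  \sum_(a <- L) (th a)^* * a x.

Lemma bdd_charsum th L : bdd (charsum th L).
Proof. by apply: bdd_sum => a _; apply: bddM; [exact: bdd_cst|exact: bdd_char]. Qed.

Lemma mean_charsum th L : circle_hom th ->
  M (charsum th L) = \sum_(a <- L) (a == 0)%:R.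
Proof.
move=> hth; rewrite (mean_sum meanM) => [|a]; last first.
  by apply: bddM; [exact: bdd_cst|exact: bdd_char].
apply: eq_bigr => a _; rewrite (meanZ meanM); last exact: bdd_char.
rewrite mean_char; have [->|_] := eqVneq a 0; last by rewrite mulr0.
by rewrite circle_hom0// rmorph1 mulr1.
Qed.

Lemma charsumM th L L' x : circle_hom th ->
  charsum th L x * charsum th L' x = charsum th [seq a + b | a <- L, b <- L'] x.
Proof.
move=> [thD _]; rewrite /charsum big_allpairs_dep/= mulr_suml.
apply: eq_bigr => a _; rewrite mulr_sumr; apply: eq_bigr => b _.
by rewrite thD rmorphM/= mulrACA.
Qed.

Fixpoint sums (L : seq D) n :=
  if n is n'.+1 then [seq a + b | a <- L, b <- sums L n'] else [:: 0].

Lemma charsumX th L n x : circle_hom th ->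
  charsum th L x ^+ n = charsum th (sums L n) x.
Proof.
move=> hth; elim: n => [|n IH]; last by rewrite exprS IH charsumM.
by rewrite expr0 /charsum big_seq1 circle_hom0// rmorph1 mul1r dual0E.
Qed.

(** Its greatest possible value 4 |F| is taken exactly where a(x) = th(a) for all a in F
    ([kernel_gap]), so high powers concentrate there. *)
Definition kernel (th : D -> C) (F : seq D) x : C :=
  \sum_(a <- F) `|1 + (th a)^* * a x| ^+ 2.

Definition kernel_chars (F : seq D) := flatten [seq [:: 0; 0; a; - a] | a <- F].

Lemma kernelE th F : circle_hom th -> kernel th F = charsum th (kernel_chars F).
Proof.
move=> hth; apply/funext => x; rewrite /kernel /charsum /kernel_chars.
rewrite big_flatten big_map; apply: eq_bigr => a _.
rewrite !big_cons big_nil !dual0E dualNE circle_hom0// circle_homN// rmorph1.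
by rewrite sqr_norm1DcM ?norm_char ?hth.2// conjCK /=; ring.
Qed.

Lemma kernel_ge0 th F x : 0 <= kernel th F x.
Proof. by apply: sumr_ge0 => a _; rewrite exprn_ge0. Qed.

Lemma kernel_gap th F x : circle_hom th ->
  kernel th F x = 4 * (size F)%:R - \sum_(a <- F) `|a x - th a| ^+ 2.
Proof.
move=> [_ th1]; rewrite -sum1_size natr_sum mulr_sumr -sumrB; apply: eq_bigr => a _.
by rewrite mulr1 sqr_norm1DcM ?norm_char// sqr_normB_unit ?norm_char//; ring.
Qed.

Lemma kernel_le th (F : seq D) x (a : D) (e : C) : circle_hom th -> 0 <= e ->
  a \in F -> e <= `|a x - th a| -> kernel th F x <= 4 * (size F)%:R - e ^+ 2.
Proof.
move=> hth e0 aF ha; rewrite kernel_gap// lerB//.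
rewrite (perm_big _ (perm_to_rem aF)) big_cons/= ler_wpDr//.
  by apply: sumr_ge0 => b _; rewrite exprn_ge0.
by rewrite lerXn2r ?nnegrE.
Qed.

(** Expanded into characters, only the trivial ones have nonzero mean, and on these th is 1. *)
Lemma mean_kernelX th F n : circle_hom th ->
  M (fun x => kernel th F x ^+ n) = M (fun x => kernel (fun=> 1) F x ^+ n).
Proof.
move=> hth; rewrite !kernelE//; last exact: circle_hom_trivial.
transitivity (M (charsum th (sums (kernel_chars F) n))).
  by congr M; apply/funext => x; rewrite charsumX.
rewrite mean_charsum// -(mean_charsum _ (circle_hom_trivial _ _)).
by congr M; apply/funext => x; rewrite charsumX//; exact: circle_hom_trivial.
Qed.

Lemma bdd_kernel th F : circle_hom th -> bdd (kernel th F).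
Proof. by move=> hth; rewrite kernelE//; exact: bdd_charsum. Qed.

Lemma mean_kernel_lower F (b : C) : 0 <= b -> b < 4 * (size F)%:R ->
  exists k : nat, forall n, b ^+ n <= k%:R * M (fun x => kernel (fun=> 1) F x ^+ n).
Proof.
move=> b0 b4; set f := kernel (fun=> 1) F.
have cf : continuous f.
  rewrite /f kernelE; last exact: circle_hom_trivial.
  apply: cfun_sum => a; apply: cfunM; first exact: cfun_cst.
  exact: char_continuous.
have f0 : f 0 = 4 * (size F)%:R.
  rewrite /f kernel_gap; last exact: circle_hom_trivial.
  by rewrite big1 ?subr0// => a _; rewrite char0 subrr normr0 expr0n.
have d0 : 0 < f 0 - b by rewrite f0 subr_gt0.
have [k hk] := mean_syndetic cX meanM (uniformly_continuous_group cX cf d0).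
exists k => n; apply: hk => [|x|x].
- by apply: bddX; apply: bdd_kernel; exact: circle_hom_trivial.
- by rewrite exprn_ge0// kernel_ge0.
move=> /(_ 0); rewrite add0r distrC => /(le_lt_trans (real_ler_norm _)).
rewrite rpredB ?ger0_real ?kernel_ge0// => /(_ isT).
rewrite ltrD2l ltrN2 => /ltW bx.
by apply: lerXn2r; rewrite ?nnegrE ?kernel_ge0.
Qed.

(** Otherwise the kernel of th stays below A = 4 |F| - e^2, so its n-th moment is at most A^n. The
    trivial kernel has the same moments, and near 0 it exceeds any b < 4 |F|, so they are at least a
    constant times b^n; b is taken halfway between A and 4 |F|. *)
Lemma bohr_dense th (F : seq D) (e : C) : circle_hom th -> 0 < e ->
  exists x, forall a, a \in F -> `|a x - th a| < e.
Proof.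
move=> hth e0; apply: contrapT => nx.
have bad x : exists2 a, a \in F & e <= `|a x - th a|.
  apply: contrapT => na; apply: nx; exists x => a aF.
  rewrite real_ltNge ?normr_real ?(gtr0_real e0)//; apply/negP => ea.
  by apply: na; exists a.
pose A := 4 * (size F)%:R - e ^+ 2.
have kA : forall y, kernel th F y <= A.
  by move=> y; have [a aF ea] := bad y; apply: kernel_le aF ea => //; exact: ltW.
have A0 : 0 <= A := le_trans (kernel_ge0 th F 0) (kA 0).
pose b := A + e ^+ 2 / 2.
have Ab : A < b by rewrite ltrDl divr_gt0// exprn_gt0.
have b4 : b < 4 * (size F)%:R.
  rewrite -subr_gt0 (_ : _ - b = e ^+ 2 / 2) ?divr_gt0 ?exprn_gt0//.
  by rewrite /b /A; field.
have [k hk] := mean_kernel_lower (le_trans A0 (ltW Ab)) b4.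
apply: (@geometric_dominates A b k%:R A0 _ Ab) => n.
rewrite (le_trans (hk n))// ler_wpM2l// -(mean_kernelX F n hth).
rewrite -[X in _ <= X](mean_cst meanM); apply: (mean_le meanM) => [||x].
- by apply: bddX; exact: bdd_kernel.
- exact: bdd_cst.
by apply: lerXn2r; rewrite ?nnegrE ?kernel_ge0.
Qed.

Lemma dual_hom_eval th : circle_hom th -> exists x, forall a : D, a x = th a.
Proof.
move=> hth.
pose P (i : D * nat) : set X := [set x | 0 <= i.2.+1%:R^-1 - `|i.1 x - th i.1|].
have cP i : closed (P i).
  apply: closed_gef; apply: cfunB; first exact: cfun_cst.
  apply: cfun_norm; apply: cfunB; last exact: cfun_cst.
  exact: char_continuous.
have [s|x _ hx] := compact_fip cX cP; last first.
  exists x => a; apply/eqP; rewrite -subr_eq0 -normr_eq0; apply/eqP.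
  apply: (@complex_archimedean R _ 1) => // N.
  by rewrite -ler_pdivlMr// mul1r -subr_ge0; exact: (hx (a, N)).
have e0 : 0 < (\sum_(i <- s) i.2).+1%:R^-1 :> C by rewrite invr_gt0.
have [x hx] := bohr_dense [seq i.1 | i <- s] hth e0.
exists x => // i si; rewrite /P/= subr_ge0 (le_trans (ltW (hx _ _)))//.
  by apply/mapP; exists i.
rewrite lef_pV2 ?posrE// ler_nat ltnS (perm_big _ (perm_to_rem si)) big_cons.
exact: leq_addr.
Qed.

(** If c is not in L, it is orthogonal to the powers f^n of a trivial kernel built from characters
    in L. But these powers concentrate where c is near 1, so the mean of f^n c could not vanish. *)
Lemma separating_subgroup_full (L : set D) :
  L 0 -> (forall a b, L a -> L b -> L (a + b)) -> (forall a, L a -> L (- a)) ->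
  (forall x, (forall a, L a -> a x = 1) -> x = 0) -> forall a, L a.
Proof.
move=> L0 LD LN Lsep c; apply: contrapT => nLc.
pose K : set X := [set x | 0 <= `|c x - 1| - 2^-1].
have clK : closed K.
  apply: closed_gef; apply: cfunB; last exact: cfun_cst.
  apply: cfun_norm; apply: cfunB; last exact: cfun_cst.
  exact: char_continuous.
have [x Kx|F' [e /andP[e0 e1] [LF' hF']]] := @chars_isolate L K clK.
  apply: contrapT => na; have x0 : x = 0.
    apply: Lsep => a La; apply/eqP/negPn/negP => ax; apply: na; exists a => //.
  move: Kx; rewrite /K/= x0 char0 subrr normr0 sub0r oppr_ge0 invr_le0.
  by rewrite lern0.
(* The zero character makes F nonempty, so that A = 4 |F| - e^2 is nonnegative. *)
pose F := 0 :: F'.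
have LF a : a \in F -> L a by rewrite inE => /predU1P[->|/LF'].
have LF_chars a : a \in kernel_chars F -> L a.
  move=> /flatten_mapP[b /LF Lb]; rewrite !inE => /or4P[] /eqP-> //.
  exact: LN.
have Lsums n a : a \in sums (kernel_chars F) n -> L a.
  elim: n a => [|n IH] a; first by rewrite inE => /eqP->.
  by move=> /allpairsP[[b1 b2]/= [/LF_chars hb1 /IH hb2 ->]]; exact: LD.
pose f := kernel (fun=> 1) F.
have hom1 := circle_hom_trivial R D.
have bf n : bdd (fun x => f x ^+ n) by apply: bddX; exact: bdd_kernel.
have Mfc n d : ~ L d -> M (fun x => f x ^+ n * d x) = 0.
  move=> nLd.
  transitivity (M (charsum (fun=> 1) [seq a + b | a <- sums (kernel_chars F) n, b <- [:: d]])).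
    congr M; apply/funext => x; rewrite -charsumM// -charsumX// /f kernelE//.
    by rewrite {3}/charsum big_seq1 rmorph1 mul1r.
  rewrite mean_charsum// big_allpairs_dep/= big_seq big1// => a /Lsums La.
  rewrite big_seq1; case: eqP => // ad; case: nLd.
  by rewrite -[d]opprK -(addr0_eq ad) opprK; exact: LN.
pose A := 4 * (size F)%:R - e ^+ 2.
have sF : 1 <= (size F)%:R :> C by rewrite ler1n.
have A0 : 0 <= A.
  rewrite subr_ge0 (@le_trans _ _ 1)//; first by rewrite exprn_ile1// ltW.
  by rewrite (le_trans sF)// ler_peMl// ler1n.
pose b := A + e ^+ 2 / 2.
have Ab : A < b by rewrite ltrDl divr_gt0// exprn_gt0.
have b4 : b < 4 * (size F)%:R.
  rewrite -subr_gt0 (_ : _ - b = e ^+ 2 / 2) ?divr_gt0 ?exprn_gt0//.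
  by rewrite /b /A; field.
have [k hk] := mean_kernel_lower (le_trans A0 (ltW Ab)) b4.
apply: (@geometric_dominates A b (k%:R * 3) A0 _ Ab) => n.
rewrite (le_trans (hk n))// -mulrA ler_wpM2l//.
have cc x : c x + (c x)^* = 2 - `|c x - 1| ^+ 2.
  by rewrite sqr_normB_unit ?normr1 ?norm_char// rmorph1; ring.
(* The factor of f^n is 1 - |c x - 1|^2. It is nonnegative off K and at least -3 everywhere, and f
   <= A wherever some character of F' is not within e of 1. *)
have lower x : - (3 * A ^+ n) <= f x ^+ n * c x + f x ^+ n * (- c) x - f x ^+ n.
  rewrite dualNE -mulrDr cc -[X in _ - X]mulr1 -mulrBr.
  have fn0 : 0 <= f x ^+ n by rewrite exprn_ge0// kernel_ge0.
  have [hx|] := pselect (forall a, a \in F' -> `|a x - 1| <= e).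
    apply: (@le_trans _ _ 0); first by rewrite oppr_le0 mulr_ge0// exprn_ge0.
    rewrite mulr_ge0//.
    have := hF' x hx; rewrite /K/= subr_ge0 => /negP; rewrite -real_ltNge// => hc.
    rewrite -addrA [- _ - 1]addrC addrA (_ : 2 - 1 = 1); last by ring.
    by rewrite subr_ge0 exprn_ile1// (le_trans (ltW hc))// invf_le1// ler1n.
  move=> nx; have {nx}[a aF ha] : exists2 a, a \in F & e <= `|a x - 1|.
    apply: contrapT => na; apply: nx => a aF; rewrite real_leNgt ?normr_real ?(gtr0_real e0)//.
    apply/negP => /ltW ea; apply: na; exists a => //; by rewrite inE aF orbT.
  have fA : f x <= A by apply: kernel_le aF ha => //; exact: ltW.
  apply: (@le_trans _ _ (f x ^+ n * - 3)).
    rewrite mulrN lerN2 mulrC ler_wpM2l//.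
    by apply: lerXn2r; rewrite ?nnegrE ?kernel_ge0.
  rewrite ler_wpM2l// -addrA [- _ - 1]addrC addrA (_ : 2 - 1 = 1); last by ring.
  rewrite lerBrDr addrC -lerBrDr (_ : 1 - - 3 = 2 ^+ 2); last by ring.
  apply: lerXn2r; rewrite ?nnegrE//.
  by rewrite (le_trans (ler_normB _ _))// norm_char normr1.
have bfc n' (d : D) : bdd (fun x => f x ^+ n' * d x) by apply: bddM => //; exact: bdd_char.
have : - (3 * A ^+ n) <= - M (fun x => f x ^+ n).
  rewrite -[X in X <= _](mean_cst meanM) -[X in _ <= X]add0r.
  rewrite -[0 in X in _ <= X]addr0 -{1}(Mfc n _ nLc) -(Mfc n (- c)); last first.
    by move=> /LN; rewrite opprK.
  rewrite -(meanD meanM)// -(meanB meanM)//; last exact: bddD.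
  apply: (mean_le meanM) => //; first exact: bdd_cst.
  by apply: bddD; [exact: bddD|exact: bddN].
by rewrite lerN2.
Qed.

End Duality.

(** * Wiener's lemma *)

Section Wiener.
Variables (R : realType) (G : zmodType).
Local Notation C := R[i]^o.
Implicit Types (s : seq (G * C)) (t : G -> C).

(** A list of pairs stands for an element of C[G], repetitions allowed; [coef] collects them. *)
Definition coef s x : C := \sum_(u <- s | u.1 == x) u.2.

Definition supp s := undup [seq u.1 | u <- s].

Lemma lincomb_supp s t : lincomb s t = \sum_(x <- supp s) coef s x * t x.
Proof.
rewrite /coef; under [RHS]eq_bigr do rewrite mulr_suml big_mkcond.
rewrite exchange_big/= [LHS]big_seq [RHS]big_seq; apply: eq_bigr => u us.
have ux : u.1 \in supp s by rewrite mem_undup map_f.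
rewrite (bigD1_seq u.1) ?undup_uniq//= eqxx big1 ?addr0// => x.
by rewrite eq_sym => /negPf ->.
Qed.

Definition delta0 (x : G) : C := (x == 0)%:R.

Lemma hermitian_sum_delta0 s :
  hermitian_sum delta0 s = \sum_(x <- supp s) `|coef s x| ^+ 2.
Proof.
transitivity (lincomb s (fun x => (coef s x)^*)).
  apply: eq_bigr => u _; rewrite /coef rmorph_sum mulr_sumr [RHS]big_mkcond.
  apply: eq_bigr => v _; rewrite /delta0 subr_eq0 eq_sym.
  by case: eqP => _; rewrite ?mulr1 ?mulr0.
by rewrite lincomb_supp; apply: eq_bigr => x _; rewrite normCK.
Qed.

Lemma posdef_delta0 : posdef delta0.
Proof.
move=> s; rewrite hermitian_sum_delta0; apply: sumr_ge0 => x _.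
exact: exprn_ge0.
Qed.

(** The square norm of s is its hermitian form at the state [delta0]. By the weak Bochner theorem
    some circle homomorphism gives the form a value as large up to e, and that value is |lincomb s
    th|^2. *)
Lemma plancherel_le s (A : C) :
  (forall th, circle_hom th -> `|lincomb s th| ^+ 2 <= A) ->
  \sum_(x <- supp s) `|coef s x| ^+ 2 <= A.
Proof.
move=> hA; rewrite -hermitian_sum_delta0.
pose L := [seq (u.1 - v.1, u.2 * v.2^*) | u <- s, v <- s].
have LE p : lincomb L p = hermitian_sum p s by rewrite /lincomb big_allpairs_dep.
have Lth th : circle_hom th -> hermitian_sum th s = `|lincomb s th| ^+ 2.
  move=> hth; rewrite normCK rmorph_sum mulr_suml; apply: eq_bigr => u _.
  rewrite mulr_sumr; apply: eq_bigr => v _.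
  by rewrite hth.1 circle_homN// rmorphM/=; ring.
have hr : hermitian_sum delta0 s \is Num.real by rewrite ger0_real// posdef_delta0.
have A0 : 0 <= A.
  by rewrite (le_trans _ (hA _ (circle_hom_trivial R G)))// exprn_ge0.
rewrite real_leNgt ?ger0_real// ?posdef_delta0//; apply/negP => Ah.
pose e := (hermitian_sum delta0 s - A) / 2.
have e0 : 0 < e by rewrite divr_gt0// subr_gt0.
have [] := @circle_hom_dominates R G delta0 L e _ posdef_delta0 e0.
  by rewrite /delta0 eqxx.
move=> th hth; have hr2 : `|lincomb s th| ^+ 2 \is Num.real by rewrite rpredX ?normr_real.
rewrite !LE (Lth _ hth) (Creal_ReP _ hr) (Creal_ReP _ hr2).
move=> /le_trans/(_ (hA _ hth)).
have -> : hermitian_sum delta0 s - e = A + e by rewrite /e; field.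
by rewrite gerDl (lt_geF e0).
Qed.

Fixpoint powers s n : seq (G * C) :=
  if n is n'.+1 then [seq (u.1 + v.1, u.2 * v.2) | u <- s, v <- powers s n']
  else [:: (0, 1)].

Lemma lincomb_powers s n th : circle_hom th ->
  lincomb (powers s n) th = lincomb s th ^+ n.
Proof.
move=> hth; elim: n => [|n IH]; first by rewrite /lincomb big_seq1 circle_hom0// mulr1.
rewrite exprS -IH /lincomb big_allpairs_dep mulr_suml; apply: eq_bigr => u _.
by rewrite mulr_sumr; apply: eq_bigr => v _; rewrite hth.1/=; ring.
Qed.

Lemma powers_fixed s n t : (forall a, lincomb s (fun k => t (a + k)) = t a) ->
  forall a, lincomb (powers s n) (fun k => t (a + k)) = t a.
Proof.
move=> st; elim: n => [|n IH] a; first by rewrite /lincomb big_seq1 mul1r addr0.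
rewrite -[RHS]st /lincomb big_allpairs_dep; apply: eq_bigr => u _.
rewrite -[t (a + u.1)]IH mulr_sumr; apply: eq_bigr => v _ /=.
by rewrite mulrA addrA.
Qed.

(** G being commutative, a product of n terms of s depends only on how often each term occurs, at
    most n times each. *)
Lemma size_supp_powers s n : (size (supp (powers s n)) <= n.+1 ^ size s)%N.
Proof.
pose key (i : 'I_(size s)) := (nth (0, 0) s i).1.
have rep m u : u \in powers s m -> exists2 f : 'I_(size s) -> nat,
    (\sum_i f i <= m)%N & u.1 = \sum_i key i *+ f i.
  elim: m u => [|m IH] u.
    by rewrite inE => /eqP ->; exists (fun=> 0%N); rewrite big1.
  move=> /allpairsP[[v w]/= [vs /IH[f fm fw] ->]] /=.
  have vi : (index v s < size s)%N by rewrite index_mem.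
  pose i0 := Ordinal vi.
  have key0 : key i0 = v.1 by rewrite /key nth_index.
  exists (fun i => (i == i0) + f i)%N.
    rewrite big_split/= (bigD1 i0)//= eqxx big1 ?addn0 ?add1n ?ltnS// => i.
    by move/negPf->.
  under eq_bigr do rewrite mulrnDr.
  rewrite big_split/= -fw (bigD1 i0)//= eqxx mulr1n key0 big1 ?addr0// => i.
  by move/negPf->.
pose val (f : {ffun 'I_(size s) -> 'I_n.+1}) := \sum_i key i *+ f i.
have : {subset supp (powers s n) <= [seq val f | f : {ffun 'I_(size s) -> 'I_n.+1}]}.
  move=> x; rewrite mem_undup => /mapP[u /rep[f fn ->] ->].
  apply/mapP; exists [ffun i => inord (f i)]; first by rewrite mem_enum.
  apply: eq_bigr => i _; rewrite ffunE inordK// ltnS (leq_trans _ fn)//.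
  by rewrite (bigD1 i)//= leq_addr.
move=> /(uniq_leq_size (undup_uniq _)) /leq_trans; apply.
by rewrite size_map -cardE card_ffun !card_ord.
Qed.

Lemma polynomial_growth (d : nat) (b : C) : 1 < b ->
  exists2 k : C, 0 <= k & forall n, n.+1%:R ^+ d <= k * b ^+ n.
Proof.
move=> b1; case: d => [|d].
  by exists 1 => // n; rewrite expr0 mul1r exprn_ege1// ltW.
(* Bernoulli's inequality for the root, raised to the power d + 1. *)
pose c := d.+1.-root b.
have c1 : 1 < c by rewrite rootC_gt1.
have [h h0 hc] : exists2 h, 0 < h & c = h + 1.
  by exists (c - 1); rewrite ?subr_gt0// subrK.
have bern n : h * n%:R + 1 <= c ^+ n.
  elim: n => [|n IH]; first by rewrite mulr0 add0r expr0.
  have c0 : 0 <= c by rewrite ltW// (lt_trans ltr01).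
  rewrite exprS (le_trans _ (ler_wpM2l c0 IH))// -subr_ge0 -[n.+1]addn1 natrD hc.
  have -> : (h + 1) * (h * n%:R + 1) - (h * (n%:R + 1) + 1) = h ^+ 2 * n%:R by ring.
  by rewrite mulr_ge0// exprn_ge0// ltW.
exists ((h^-1 + 1) ^+ d.+1) => [|n].
  by rewrite exprn_ge0// addr_ge0// invr_ge0 ltW.
have -> : b ^+ n = (c ^+ n) ^+ d.+1 by rewrite exprAC rootCK.
have k0 : 0 <= h^-1 + 1 by rewrite addr_ge0// invr_ge0 ltW.
rewrite -exprMn; apply: lerXn2r; rewrite ?nnegrE//.
  by rewrite mulr_ge0// exprn_ge0// ltW// (lt_trans ltr01).
rewrite (le_trans _ (ler_wpM2l k0 (bern n)))// -subr_ge0 -[n.+1]addn1 natrD.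
have -> : (h^-1 + 1) * (h * n%:R + 1) - (n%:R + 1) = h^-1 + h * n%:R.
  by field; rewrite gt_eqF.
by rewrite addr_ge0 ?invr_ge0 ?mulr_ge0// ltW.
Qed.

(** The function t is also fixed by s^n. Cauchy-Schwarz bounds |t a|^2 by the support size of s^n,
    polynomial in n, times its square norm, at most rho^(2n) by [plancherel_le], times B^2. *)
Lemma contraction_fixed_point s (rho : C) t : 0 < rho < 1 ->
  (forall th, circle_hom th -> `|lincomb s th| <= rho) ->
  bdd t -> (forall a, lincomb s (fun k => t (a + k)) = t a) ->
  forall a, t a = 0.
Proof.
move=> /andP[rho0 rho1] hs [B tB] st a.
have B0 : 0 <= B := le_trans (normr_ge0 _) (tB 0).
have bound n : `|t a| ^+ 2 <= n.+1%:R ^+ size s * (rho ^+ 2) ^+ n * B ^+ 2.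
  rewrite -(powers_fixed n st a) lincomb_supp.
  apply: (le_trans (norm_sum_sqr _ _)).
  apply: (@le_trans _ _ ((size (supp (powers s n)))%:R *
      ((\sum_(x <- supp (powers s n)) `|coef (powers s n) x| ^+ 2) * B ^+ 2))).
    rewrite ler_wpM2l// mulr_suml ler_sum// => x _; rewrite normrM exprMn.
    by rewrite ler_wpM2l ?exprn_ge0//; apply: lerXn2r; rewrite ?nnegrE.
  rewrite -mulrA; apply: ler_pM => //.
  - by rewrite mulr_ge0 ?exprn_ge0// sumr_ge0// => x _; rewrite exprn_ge0.
  - by rewrite -natrX ler_nat size_supp_powers.
  rewrite ler_wpM2r ?exprn_ge0//; apply: plancherel_le => th hth.
  rewrite lincomb_powers// normrX -exprM mulnC exprM; apply: lerXn2r.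
  - by rewrite nnegrE exprn_ge0.
  - by rewrite nnegrE exprn_ge0// ltW.
  by apply: lerXn2r; rewrite ?nnegrE ?hs// ltW.
apply/eqP/negPn/negP => ta.
have ta0 : 0 < `|t a| ^+ 2 by rewrite exprn_gt0// normr_gt0.
have rho1' : 1 < rho^-1 by rewrite invf_gt1.
(* One of the two factors rho^n absorbs the polynomial; the other still tends to 0. *)
have [k k0 hk] := polynomial_growth (size s) rho1'.
apply: (@geometric_dominates R rho 1 (`|t a| ^- 2 * (k * B ^+ 2)) (ltW rho0) _ rho1) => n.
rewrite expr1n -mulrA ler_pdivlMl// mulr1 (le_trans (bound n))//.
rewrite [X in _ <= X]mulrAC; apply: ler_wpM2r; first exact: exprn_ge0.
have r2 : 0 <= (rho ^+ 2) ^+ n by do 2!apply: exprn_ge0; exact: ltW.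
rewrite (le_trans (ler_wpM2r r2 (hk n)))// -mulrA ler_wpM2l// exprVn -exprM mulnC exprM expr2 mulKf//.
by rewrite expf_neq0// gt_eqF.
Qed.

Definition gr_coefs (F : group_ring G) : seq (G * C) :=
  [seq (k, (monalg.mcoeff k F)%:~R) | k <- finmap.enum_fset (monalg.msupp F)].

Lemma lincomb_gr_coefs F p : lincomb (gr_coefs F) p = gr_sum p F.
Proof. by rewrite /lincomb big_map; apply: eq_bigr => k _; rewrite mulrC mulrzr. Qed.

Lemma wiener_injective (F : group_ring G) (e : C) t : 0 < e ->
  (forall th : G -> C, circle_hom th -> e <= gr_sum th F) -> bdd t ->
  (forall a, gr_sum (fun k => t (a + k)) F = 0) -> forall a, t a = 0.
Proof.
move=> e0 hF bt Ft.
set S := gr_coefs F; have SE := lincomb_gr_coefs F.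
(* More than the l1 norm of F, so that 1 - F / c takes values in [0, 1 - e / c] on circle
   homomorphisms; it fixes t because F annihilates t. *)
pose c : C := \sum_(u <- S) `|u.2| + 1.
have c1 : 1 <= c by rewrite lerDr sumr_ge0.
have c0 : 0 < c := lt_le_trans ltr01 c1.
have cF th : circle_hom th -> gr_sum th F <= c - 1.
  move=> hth; have F0 := le_trans (ltW e0) (hF _ hth).
  rewrite addrK -(ger0_norm F0) -SE -/S (le_trans (ler_norm_sum _ _ _))//.
  by rewrite ler_sum// => u _; rewrite normrM hth.2 mulr1.
have hom1 := circle_hom_trivial R G.
have ec : e < c.
  by rewrite (le_lt_trans (hF _ hom1))// (le_lt_trans (cF _ hom1))// gtrBl.
pose s := (0, 1) :: [seq (u.1, - (u.2 / c)) | u <- S].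
have sE p : lincomb s p = p 0 - gr_sum p F / c.
  rewrite /lincomb big_cons mul1r; congr (_ + _).
  rewrite -SE -/S /lincomb mulr_suml -sumrN big_map; apply: eq_bigr => u _ /=.
  by rewrite mulNr mulrAC.
apply: (@contraction_fixed_point s (1 - e / c)) => //.
- rewrite subr_gt0 ltr_pdivrMr// mul1r ec/= gtrBl.
  exact: divr_gt0.
- move=> th hth; rewrite sE circle_hom0// ger0_norm.
    by rewrite lerB// ler_pM2r ?invr_gt0// hF.
  rewrite subr_ge0 ler_pdivrMr// mul1r (le_trans (cF _ hth))//.
  by rewrite gerBl.
- by move=> a; rewrite sE Ft mul0r subr0 addr0.
Qed.

End Wiener.

(** * The unit circle *)

Section CircleParametrization.
Variable R : realType.
Local Notation C := R[i]^o.

Definition cis (t : R) : C := (cos t +i* sin t)%C.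

Lemma cis0 : cis 0 = 1.
Proof. by rewrite /cis cos0 sin0. Qed.

Lemma cisD t u : cis (t + u) = cis t * cis u.
Proof. by rewrite /cis cosD sinD; congr Complex; ring. Qed.

Lemma norm_cis t : `|cis t| = 1.
Proof. by rewrite normc_def/= cos2Dsin2 sqrtr1. Qed.

Lemma cis_eq1 t : `|t| < pi -> cis t = 1 -> t = 0.
Proof.
move=> tpi [_ st]; have [t0|t0|//] := ltgtP t 0.
  have : 0 < sin (- t) by rewrite sin_gt0_pi// oppr_gt0 t0/= -(ltr0_norm t0).
  by rewrite sinN st oppr0 ltxx.
have : 0 < sin t by rewrite sin_gt0_pi// t0/= -(gtr0_norm t0).
by rewrite st ltxx.
Qed.

Lemma cis_near1 (e : C) : 0 < e ->
  exists2 d : R, 0 < d & forall t, `|t| < d -> `|cis t - 1| < e.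
Proof.
move=> e0.
have cE : continuous (fun t : R => (cos t)%:C%C + 'i%C * (sin t)%:C%C : C).
  move=> t; apply: cvgD.
    exact: (continuous_comp (@continuous_cos R t) (@real_complex_continuous R _)).
  apply: cvgM; first exact: cvg_cst.
  exact: (continuous_comp (@continuous_sin R t) (@real_complex_continuous R _)).
have cisE t : cis t = (cos t)%:C%C + 'i%C * (sin t)%:C%C by rewrite [LHS]complexE.
have /nbhs_ballP[d /= d0 hd] := @cvgr_dist_lt _ C _ _ (nbhs_filter _) _ _ (cE 0) _ e0.
exists d => // t td; have := hd t; rewrite /ball/= sub0r normrN => /(_ td).
by rewrite -!cisE cis0 distrC.
Qed.

Lemma cis_lift (eta : R) : 0 < eta -> exists2 d : C, 0 < d &
  forall z : C, `|z| = 1 -> `|z - 1| < d -> exists2 t, `|t| <= eta & cis t = z.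
Proof.
move=> eta0.
have asin0 : asin 0 = 0 :> R.
  by rewrite -[in LHS]sin0 sinK// in_itv/= oppr_le0 andbb divr_ge0// pi_ge0.
have ca : {for 0, continuous (@asin R)}.
  by apply: continuous_asin; rewrite ltrN10 ltr01.
have /nbhs_ballP[d /= d0 hd] := @cvgr_dist_lt _ R _ _ (nbhs_filter _) _ _ ca _ eta0.
(* Distance below 1 forces Re z > 0, where the arcsine of Im z is an argument of z; distance below d
   makes it at most eta. *)
pose m := Num.min d 1; exists (m%:C%C : C); first by rewrite ltcR lt_min d0 ltr01.
move=> z z1 hz; have zE : z = (complex.Re z +i* complex.Im z)%C by case: (z).
set a := complex.Re z in zE *; set b := complex.Im z in zE *.
have ab : a ^+ 2 + b ^+ 2 = 1.
  by apply: complexI; rewrite add_Re2_Im2 z1 expr1n.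
have hRe : `|a - 1| < Num.min d 1.
  rewrite -ltcR; apply: le_lt_trans hz.
  by have := normc_ge_Re (z - 1); rewrite zE /=.
have hIm : `|b| < Num.min d 1.
  rewrite -ltcR; apply: le_lt_trans hz.
  have := normc_ge_Re ((z - 1) * 'i%C); rewrite ReiNIm normrN normrM.
  rewrite [`|'i%C|]normc_def /= expr0n/= expr1n add0r sqrtr1 mulr1.
  by rewrite zE /= oppr0 addr0.
have a0 : 0 < a.
  move: hRe; rewrite lt_min => /andP[_]; rewrite distrC => /(le_lt_trans (ler_norm _)).
  by rewrite gtrBl.
have b1 : -1 <= b <= 1.
  by rewrite -ler_norml; move: hIm; rewrite lt_min => /andP[_ /ltW].
exists (asin b).
  have := hd b; rewrite /ball/= sub0r normrN asin0 sub0r normrN => h.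
  by apply/ltW/h; move: hIm; rewrite lt_min => /andP[].
rewrite zE /cis cos_asin// asinK ?in_itv//=.
by rewrite -ab addrK sqrtr_sqr gtr0_norm.
Qed.

End CircleParametrization.

(** * Unitary characters of the group ring *)

Section GroupRingCharacters.
Variables (R : realType) (G : zmodType).
Local Notation C := R[i]^o.
Local Notation W := (prod_topology (fun _ : G => C)).
Implicit Types (f g : group_ring G) (th : G -> C).

Lemma gr_sum_homM th f g : circle_hom th ->
  gr_sum th (f * g) = gr_sum th f * gr_sum th g.
Proof.
move=> [thD _]; rewrite [LHS]gr_sum_mul /gr_sum mulr_suml.
apply: eq_bigr => k _; rewrite mulr_sumr mulrz_suml.
apply: eq_bigr => l _; by rewrite thD mulrzAl mulrzAr.
Qed.

Lemma gr_sum_hom1 th : circle_hom th -> gr_sum th 1 = 1.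
Proof. by move=> hth; rewrite [LHS]gr_sum_gr_of circle_hom0. Qed.

Lemma gr_sumN th f : gr_sum th (- f) = - gr_sum th f.
Proof. by apply/eqP; rewrite -addr_eq0 -gr_sumD addNr gr_sum0. Qed.

Lemma gr_sumB th f g : gr_sum th (f - g) = gr_sum th f - gr_sum th g.
Proof. by rewrite gr_sumD gr_sumN. Qed.

Definition gr_adj f : group_ring G := gr_sum (fun k => gr_of (- k)) f.

Lemma gr_sum_adj th f : circle_hom th -> gr_sum th (gr_adj f) = (gr_sum th f)^*.
Proof.
move=> hth; rewrite gr_sum_sum -!lincomb_gr_coefs /lincomb rmorph_sum !big_map.
apply: eq_bigr => k _; rewrite gr_sum_gr_of circle_homN// rmorphM/=.
by rewrite rmorph_int.
Qed.

Variable M : lmodType (group_ring G).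
Implicit Types s : M.

Lemma circle_hom_of_ann_quot s (phi : {rmorphism ann_quot s -> R[i]}) :
  subgroup_of_circle (phi @` image_of_group s) ->
  exists2 th : G -> C, circle_hom th & forall f, f *: s = 0 -> gr_sum th f = 0.
Proof.
move=> [circ _ _]; pose th k : C := phi (ann_pi s (gr_of k)).
have sumE f : gr_sum th f = phi (ann_pi s f).
  rewrite -[in RHS](gr_sum_of f) (gr_sum_morph (ann_pi s)) (gr_sum_morph phi).
  exact: eq_gr_sum.
exists th => [|f fs].
  split=> [k l|k]; first by rewrite /th gr_ofD !rmorphM.
  by apply: circ; exists (ann_pi s (gr_of k)) => //; exists k.
have fE : ann_pi s f = ann_pi s 0 by apply/ann_piP; rewrite subr0.
by rewrite sumE fE !rmorph0.
Qed.

(** With the previous lemma, condition (ii) becomes a statement about circle homomorphisms of G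
    whose extension vanishes on the annihilator. *)
Lemma ann_quot_of_circle_hom s th : circle_hom th ->
  (forall f, f *: s = 0 -> gr_sum th f = 0) ->
  exists phi : {rmorphism ann_quot s -> R[i]},
    subgroup_of_circle (phi @` image_of_group s).
Proof.
move=> hth hs; pose F (x : ann_quot s) : R[i] := gr_sum th (ann_repr x).
have FE f : F (ann_pi s f) = gr_sum th f.
  apply/eqP; rewrite -subr_eq0 -gr_sumB; apply/eqP/hs/ann_piP.
  exact: ann_reprK.
have FB : zmod_morphism F.
  move=> x y; rewrite -[x]ann_reprK -[y]ann_reprK -ann_piB !FE.
  exact: gr_sumB.
have FM : monoid_morphism F.
  split=> [|x y]; first by rewrite [LHS]FE gr_sum_hom1.
  rewrite -[x]ann_reprK -[y]ann_reprK -rmorphM !FE.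
  exact: gr_sum_homM.
pose mZ := GRing.isZmodMorphism.Build (ann_quot s) R[i] F FB.
pose mM := GRing.isMonoidMorphism.Build (ann_quot s) R[i] F FM.
pose phi : {rmorphism ann_quot s -> R[i]} := HB.pack F mZ mM.
exists phi.
have img z : (phi @` image_of_group s) z <-> exists k, z = th k.
  split=> [[_ [k _ <-] <-]|[k ->]].
    by exists k; rewrite -[RHS]gr_sum_gr_of -FE.
  exists (ann_pi s (gr_of k)); first by exists k.
  by rewrite -[RHS]gr_sum_gr_of -FE.
split=> [z /img[k ->]||x y /img[k ->] /img[l ->]].
- exact: hth.2.
- by apply/img; exists 0; rewrite circle_hom0.
- apply/img; exists (k - l); rewrite hth.1 circle_homN//; congr (_ * _).
  have tl0 : th l != 0 by rewrite -normr_eq0 hth.2 oner_neq0.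
  by apply: (mulfI tl0); rewrite divff// -normCK hth.2 expr1n.
Qed.

(** By compactness finitely many f suffice to detect all th. The sum F of their products with their
    adjoints still kills s, and th(F) is a sum of |th(f)|^2, positive on a compact space, so it
    attains a positive minimum. *)
Lemma spectral_gap s :
  (forall th, circle_hom th -> exists2 f, f *: s = 0 & gr_sum th f != 0) ->
  exists F, F *: s = 0 /\
    exists2 e : C, 0 < e & forall th, circle_hom th -> e <= gr_sum th F.
Proof.
move=> gap.
have csum f : continuous (fun th : W => gr_sum th f).
  rewrite (_ : (fun th => _) = fun th : W => lincomb (gr_coefs R f) th).
    apply: cfun_sum => u; apply: cfunM; first exact: cfun_cst.
    exact: continuous_eval.
  by apply/funext => th; rewrite lincomb_gr_coefs.
pose P f : set W := [set th | f *: s = 0 -> gr_sum th f = 0].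
have clP f : closed (P f).
  by apply: closed_imply => _; apply: closed_eqf => //; exact: cfun_cst.
have [fs hfs] : exists fs : seq (group_ring G), forall th, circle_hom th ->
    exists2 f, f \in fs & f *: s = 0 /\ gr_sum th f != 0.
  apply: contrapT => nfs.
  have [fs|th hth hP] := compact_fip (@compact_circle_homs R G) clP; last first.
    by have [f fs0 /eqP] := gap _ hth; apply; exact: hP.
  apply: contrapT => nth; apply: nfs; exists fs => th hth.
  apply: contrapT => nf; apply: nth; exists th => // f ffs fs0.
  by apply/eqP/negPn/negP => f0; apply: nf; exists f.
pose F := \sum_(f <- fs | f *: s == 0) gr_adj f * f.
have FE th : circle_hom th ->
    gr_sum th F = \sum_(f <- fs | f *: s == 0) `|gr_sum th f| ^+ 2.
  move=> hth; rewrite /F; elim/big_rec2: _ => [|f y x _ <-]; first exact: gr_sum0.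
  by rewrite gr_sumD gr_sum_homM// gr_sum_adj// mulrC -normCK.
have F0 th : circle_hom th -> 0 < gr_sum th F.
  move=> hth; have [f ffs [/eqP fs0 f0]] := hfs _ hth.
  rewrite FE// (perm_big _ (perm_to_rem ffs)) big_cons fs0 ltr_pwDl//.
    by rewrite exprn_gt0// normr_gt0.
  by apply: sumr_ge0 => g _; rewrite exprn_ge0.
exists F; split.
  rewrite scaler_suml big1// => f /eqP fs0.
  by rewrite -scalerA fs0 scaler0.
have cf : continuous (fun th : W => complex.Re (gr_sum th F)).
  by move=> th; exact: (continuous_comp (csum F th) (@continuous_Re R _)).
have [|th /set_mem hth thmin] :=
    compact_EVT_min _ (@compact_circle_homs R G) (continuous_subspaceT cf).
  by exists (fun=> 1); exact: circle_hom_trivial.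
have re th' : circle_hom th' -> (complex.Re (gr_sum th' F))%:C%C = gr_sum th' F.
  by move=> h'; rewrite RRe_real// gtr0_real// F0.
exists (gr_sum th F); first exact: F0.
move=> th' hth'; rewrite -(re _ hth) -(re _ hth') lecR.
by apply: thmin; exact/mem_set.
Qed.

End GroupRingCharacters.

(** * Finitely generated modules *)

Section Span.
Variables (A : comNzRingType) (M : lmodType A).
Implicit Types (S T : set M) (m : M).

Definition lspan S m := exists2 r : seq (A * M),
  (forall u, u \in r -> S u.2) & m = \sum_(u <- r) u.1 *: u.2.

Lemma lspan_mem S m : S m -> lspan S m.
Proof.
by move=> Sm; exists [:: (1, m)] => [u|]; rewrite ?big_seq1 ?scale1r// inE => /eqP->.
Qed.

Lemma lspan0 S : lspan S 0.
Proof. by exists [::] => //; rewrite big_nil. Qed.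

Lemma lspanD S m m' : lspan S m -> lspan S m' -> lspan S (m + m').
Proof.
move=> [r hr ->] [r' hr' ->]; exists (r ++ r'); last by rewrite big_cat.
by move=> u; rewrite mem_cat => /orP[/hr|/hr'].
Qed.

Lemma lspanZ S f m : lspan S m -> lspan S (f *: m).
Proof.
move=> [r hr ->]; exists [seq (f * u.1, u.2) | u <- r].
  by move=> _ /mapP[u /hr Su ->].
by rewrite big_map scaler_sumr; apply: eq_bigr => u _; rewrite scalerA.
Qed.

Lemma lspanN S m : lspan S m -> lspan S (- m).
Proof. by move=> /(lspanZ (- 1)); rewrite scaleN1r. Qed.

Lemma lspan_sum S (I : Type) (r : seq I) (P : pred I) (F : I -> M) :
  (forall i, P i -> lspan S (F i)) -> lspan S (\sum_(i <- r | P i) F i).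
Proof. by move=> SF; elim/big_rec: _ => [|i x Pi]; [exact: lspan0|exact/lspanD/SF]. Qed.

Lemma lspan_trans S T m : (forall a, S a -> lspan T a) -> lspan S m -> lspan T m.
Proof.
move=> ST [r hr ->]; rewrite big_seq; apply: lspan_sum => u /hr/ST.
exact: lspanZ.
Qed.

Lemma generatesE S : generates S <-> forall m, lspan S m.
Proof.
split=> [gS m|gS m].
  have [n [f [s [Ss ->]]]] := gS m; apply: lspan_sum => i _.
  exact/lspanZ/lspan_mem.
have [r hr ->] := gS m; exists (size r), (fun i => (nth 0 r i).1), (fun i => (nth 0 r i).2).
split=> [i|]; first by apply: hr; exact: mem_nth.
by rewrite (big_nth 0) big_mkord.
Qed.

Lemma lspan_finite S m : lspan S m ->
  exists2 t : seq M, (forall a, a \in t -> S a) & lspan [set` t] m.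
Proof.
move=> [r hr mE]; exists [seq u.2 | u <- r]; first by move=> _ /mapP[u /hr ? ->].
by exists r => // u ur; apply/mapP; exists u.
Qed.

Lemma finite_generating_subset S : generates S -> finitely_generated M ->
  exists2 t : seq M, (forall a, a \in t -> S a) & forall m, lspan [set` t] m.
Proof.
move=> /generatesE gS [T /finite_seqP[l ->] /generatesE gT].
suff [t tS lt] : exists2 t : seq M, (forall a, a \in t -> S a) &
    forall a, a \in l -> lspan [set` t] a.
  by exists t => // m; exact: lspan_trans (gT m).
elim: l {gT} => [|a l [t tS lt]]; first by exists [::].
have [t' tS' at'] := lspan_finite (gS a).
have mono (u v : seq M) m : {subset u <= v} -> lspan [set` u] m -> lspan [set` v] m.
  by move=> uv; apply: lspan_trans => b /uv; exact: lspan_mem.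
exists (t ++ t') => [b|b]; first by rewrite mem_cat => /orP[/tS|/tS'].
rewrite inE => /predU1P[->|/lt]; [apply: mono at'|apply: mono] => c ct.
  by rewrite mem_cat ct orbT.
by rewrite mem_cat ct.
Qed.

Lemma lspan_coordinates (t : seq M) m : lspan [set` t] m ->
  exists f : 'I_(size (undup t)) -> A, m = \sum_i f i *: (undup t)`_i.
Proof.
set v := undup t => -[r hr ->].
exists (fun i : 'I_(size v) => \sum_(u <- r | u.2 == v`_i) u.1).
under [RHS]eq_bigr do rewrite scaler_suml big_mkcond.
rewrite exchange_big/= [LHS]big_seq [RHS]big_seq; apply: eq_bigr => u /hr ut.
have uv : (index u.2 v < size v)%N by rewrite index_mem mem_undup.
rewrite (bigD1 (Ordinal uv))//= nth_index ?mem_undup// eqxx big1 ?addr0// => i.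
move=> /eqP iu; case: eqP => // ui; case: iu; apply: val_inj => /=.
by rewrite ui index_uniq// undup_uniq.
Qed.

End Span.

Section MaximalMinor.
Variable C : fieldType.

(** A linearly independent family in V of maximal size p spans V. Either p = k, or some nonzero
    column is annihilated by it. *)
Lemma rows_span_or_annihilated k (V : set 'rV[C]_k) :
  (exists2 B : 'M[C]_k, B \in unitmx & forall i, V (row i B)) \/
  (exists2 l : 'cV[C]_k, l != 0 & forall v, V v -> v *m l = 0).
Proof.
pose P p := `[< exists B : 'M[C]_(p, k), row_free B /\ forall i, V (row i B) >].
have P0 : exists p, P p.
  exists 0%N; apply/asboolP; exists 0; split; last by case.
  by rewrite /row_free mxrank0.
have Pk p : P p -> (p <= k)%N.
  by move=> /asboolP[B [/eqP rB _]]; rewrite -rB rank_leq_col.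
case: (ex_maxnP P0 Pk) => p /asboolP[B [fB VB]] pmax.
have [pk|pk] := eqVneq p k.
  left; case: k / pk V {P P0 Pk pmax} B fB VB => V B fB VB.
  by exists B => //; rewrite -row_free_unit.
right.
have rB : \rank B = p by exact/eqP.
have pltk : (p < k)%N by rewrite ltn_neqAle pk -rB rank_leq_col.
have kerB : kermx B^T != 0.
  by rewrite kermx_eq0 -row_leq_rank mxrank_tr rB -ltnNge.
have [i ri] : exists i, row i (kermx B^T) != 0.
  apply: contrapT => nr; move/eqP: kerB; apply; apply/row_matrixP => i.
  rewrite row0; apply/eqP/negPn/negP => ri; apply: nr; by exists i.
exists (row i (kermx B^T))^T.
  by apply: contraNneq ri => /(congr1 trmx); rewrite trmxK trmx0 => ->.
have Bl : B *m (row i (kermx B^T))^T = 0.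
  by rewrite -{1}[B]trmxK -trmx_mul -row_mul mulmx_ker row0 trmx0.
move=> v Vv; have vB : (v <= B)%MS.
  apply: contraT => nvB.
  have : P p.+1.
    apply/asboolP; exists (col_mx v B); split; last first.
      move=> j; rewrite -(splitK (j : 'I_(1 + p))).
      case: (fintype.split _) => j'; rewrite /unsplit.
        by have -> : row (lshift p j') (col_mx v B) = v by rewrite rowKu row_id.
      by have -> : row (rshift 1 j') (col_mx v B) = row j' B by rewrite rowKd.
    have : (B < v + B)%MS by rewrite ltmxE addsmxSr addsmx_sub (negPf nvB).
    move=> /rank_ltmx; rewrite rB addsmxE => hr.
    by rewrite /row_free eqn_leq hr rank_leq_row.
  by move=> /pmax; rewrite ltnn.
by have /submxP[D ->] := vB; rewrite -mulmxA Bl mulmx0.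
Qed.

End MaximalMinor.

(** * Expansive actions *)

Section EquivariantFunctional.
Variables (A : comNzRingType) (M : lmodType A) (C : fieldType).
Variable phi : {rmorphism A -> C}.

(* A determinant form of Nakayama's lemma: were the images under phi of the   *)
(* relations between the generators to span C^k, Cramer's rule would give a   *)
(* determinant outside the kernel of phi which annihilates M.                 *)
Lemma equivariant_functional (t : seq M) (s : M) :
  (forall m, lspan [set` t] m) -> (forall f, f *: s = 0 -> phi f = 0) ->
  exists psi : M -> C, [/\ forall m m', psi (m + m') = psi m + psi m',
    forall f m, psi (f *: m) = phi f * psi m & exists m, psi m = 1].
Proof.
move=> gen hs; pose v := undup t; pose k := size v.
have [rep repP] := choice (fun m => lspan_coordinates (gen m)).
pose rel (f : 'I_k -> A) := \sum_i f i *: v`_i = 0.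
pose V : set 'rV[C]_k := [set w | exists2 f, rel f & w = \row_i phi (f i)].
have [[B Bu BV]|[l l0 hl]] := rows_span_or_annihilated V.
  have [b hb] := choice (fun i => (let: ex_intro2 f rf wf := BV i in
    ex_intro (fun f => rel f /\ row i B = \row_j phi (f j)) f (conj rf wf)) :
    exists f, rel f /\ row i B = \row_j phi (f j)).
  pose Bm : 'M[A]_k := \matrix_(i, j) b i j.
  have BE : map_mx phi Bm = B.
    apply/row_matrixP => i; rewrite (hb i).2; apply/rowP => j.
    by rewrite !mxE.
  have det_kill (j : 'I_k) : \det Bm *: v`_j = 0.
    transitivity (\sum_(l < k) ((\adj Bm *m Bm) j l) *: v`_l).
      rewrite mul_adj_mx (bigD1 j)//= !mxE eqxx mulr1n big1 ?addr0// => l lj.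
      by rewrite !mxE eq_sym (negPf lj) mulr0n scale0r.
    under eq_bigr do rewrite mxE scaler_suml.
    rewrite exchange_big big1// => i _.
    under eq_bigr do rewrite -scalerA.
    rewrite -scaler_sumr [X in _ *: X](_ : _ = 0) ?scaler0//.
    by rewrite -[RHS](hb i).1; apply: eq_bigr => l _; rewrite mxE.
  have : phi (\det Bm) = 0.
    apply: hs; rewrite (repP s).
    rewrite scaler_sumr big1// => i _.
    by rewrite scalerA mulrC -scalerA det_kill scaler0.
  by move/eqP; rewrite -det_map_mx BE; move: Bu; rewrite unitmxE unitfE => /negPf->.
(* Since l annihilates the images of the relations, this depends only on the element of M with
   coordinates f, and so defines psi. *)
pose ev (f : 'I_k -> A) := \sum_i phi (f i) * l i 0.
have ev_rel (f : 'I_k -> A) : rel f -> ev f = 0.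
  move=> rf; have := hl _ (ex_intro2 _ _ f rf erefl).
  move=> /(congr1 (fun B : 'M[C]_1 => B 0 0)); rewrite !mxE => <-.
  by apply: eq_bigr => i _; rewrite !mxE.
have evE m (f : 'I_k -> A) : m = \sum_i f i *: v`_i -> ev (rep m) = ev f.
  move=> mE; apply/eqP; rewrite -subr_eq0 /ev -sumrB.
  rewrite -[X in _ == X](ev_rel (fun i => rep m i - f i)).
    by apply/eqP; apply: eq_bigr => i _; rewrite rmorphB mulrBl.
  rewrite /rel; under eq_bigr do rewrite scalerBl.
  by rewrite sumrB -repP -mE subrr.
pose psi m := ev (rep m).
have psiD m m' : psi (m + m') = psi m + psi m'.
  rewrite /psi (evE _ (fun i => rep m i + rep m' i)).
    by rewrite /ev -big_split; apply: eq_bigr => i _; rewrite rmorphD mulrDl.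
  by under eq_bigr do rewrite scalerDl; rewrite big_split -!repP.
have psiZ f m : psi (f *: m) = phi f * psi m.
  rewrite /psi (evE _ (fun i => f * rep m i)).
    by rewrite /ev mulr_sumr; apply: eq_bigr => i _; rewrite rmorphM mulrA.
  by under eq_bigr do rewrite -scalerA; rewrite -scaler_sumr -repP.
have [i li] : exists i, l i 0 != 0.
  apply: contrapT => nl; move/eqP: l0; apply; apply/matrixP => i j.
  rewrite [j]ord1 mxE; apply/eqP/negPn/negP => li; apply: nl; by exists i.
have psi_i : psi v`_i = l i 0.
  rewrite /psi (evE _ (fun j => (j == i)%:R)).
    rewrite /ev (bigD1 i)//= eqxx rmorph1 mul1r big1 ?addr0// => j /negPf->.
    by rewrite rmorph0 mul0r.
  by rewrite (bigD1 i)//= eqxx scale1r big1 ?addr0// => j /negPf->; rewrite scale0r.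
exists (fun m => psi m / l i 0); split=> [m m'|f m|].
- by rewrite psiD mulrDl.
- by rewrite psiZ mulrA.
- by exists v`_i; rewrite psi_i divff.
Qed.

End EquivariantFunctional.

Section Action.
Variables (R : realType) (G : zmodType) (X : topologicalZmodType).
Variable alpha : aut_action G X.
Local Notation C := R[i]^o.
Local Notation D := (dual R X).
Local Notation M := (dual_module R alpha).

Lemma metrizable_separated : compact [set: X] -> metrizable R X ->
  forall x : X, x != 0 -> exists a : D, a x != 1.
Proof.
move=> cX [d [d0 dC dT dN]] x x0.
pose f (y : X) : C := (d 0 y)%:C%C.
apply: (@dual_separates R X cX f).
- have cd : continuous (d 0).
    move=> y; apply/(@cvgrPdist_lt _ R _ _ (nbhs_filter y)) => e e0.
    apply/dN; exists e => // z /= dyz; rewrite ltr_norml; apply/andP; split.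
      by rewrite ltrBrDl ltrBlDr (le_lt_trans (dT 0 y z))// ltrD2l.
    by rewrite ltrBlDr (le_lt_trans (dT 0 z y))// [e + _]addrC ltrD2l dC.
  by move=> y; exact: (continuous_comp (cd y) (@real_complex_continuous R _)).
- by move=> y; apply/CrealP; rewrite complex_real.
- apply: contra x0 => /eqP/complexI; rewrite (_ : d 0 0 = 0); last exact/d0.
  by move=> /d0 ->.
Qed.

Lemma act_zero g : alpha g 0 = 0.
Proof. by apply: (addrI (alpha g 0)); rewrite -actD !addr0. Qed.

Lemma bigcap_actP (N : set X) x :
  (\bigcap_(g in [set: G]) (alpha g @` N)) x <-> forall g, N (alpha g x).
Proof.
split=> [h g|h g _].
  have [y Ny <-] := h (- g) I.
  by rewrite -act_comp subrr act0.
by exists (alpha (- g) x) => //; rewrite -act_comp subrr act0.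
Qed.

Lemma expansiveP : expansive alpha <->
  exists2 N : set X, nbhs 0 N & forall x, (forall g, N (alpha g x)) -> x = 0.
Proof.
split=> [[N N0 NE]|[N N0 NE]]; exists N => //.
  by move=> x /bigcap_actP; rewrite NE.
apply/seteqP; split=> x; first by move=> /bigcap_actP/NE.
move=> ->; apply/bigcap_actP => g; rewrite act_zero.
exact: nbhs_singleton.
Qed.

(** Real lifts along the orbit linearise the module structure. *)
Lemma scale_cis (a : M) (f : group_ring G) x (t : G -> R) :
  (forall k, (a : D) (alpha k x) = cis (t k)) ->
  ((f *: a : M) : D) x = cis (gr_sum t f).
Proof.
move=> at_; have Mz (b : D) u (c : int) : b x = cis u -> (b *~ c) x = cis (u *~ c).
  move=> bu; have Mn n : (b *+ n) x = cis (u *+ n).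
    elim: n => [|n IH]; first by rewrite !mulr0n dual0E cis0.
    by rewrite !mulrSr dualDE IH bu cisD.
  case: c => n; first by rewrite -!pmulrn.
  rewrite !NegzE !mulrNz -!pmulrn dualNE Mn.
  have cn : cis (u *+ n.+1) != 0 by rewrite -normr_eq0 norm_cis oner_neq0.
  by apply: (mulfI cn); rewrite -cisD subrr cis0 -normCK norm_cis expr1n.
rewrite -[f *: a]/(dual_scale f a) /dual_scale /gr_sum.
elim/big_rec2: _ => [|k b u _ bu]; first by rewrite dual0E cis0.
by rewrite [LHS]dualDE cisD bu; congr (_ * _); apply: Mz; exact: at_.
Qed.

Lemma scale_eval1 (a : M) (f : group_ring G) x :
  (forall k, (a : D) (alpha k x) = 1) -> ((f *: a : M) : D) x = 1.
Proof.
move=> ha; rewrite (@scale_cis a f x (fun=> 0)) => [|k]; last by rewrite cis0.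
by rewrite /gr_sum big1 ?cis0// => k _; rewrite mul0rz.
Qed.

Lemma lspan_eval1 (S : set M) (a : M) x :
  (forall b : M, S b -> forall k, (b : D) (alpha k x) = 1) -> lspan S a ->
  (a : D) x = 1.
Proof.
move=> hS [r hr ->]; rewrite big_seq; elim/big_rec: _ => // u b ur bx.
by rewrite [LHS]dualDE bx mulr1; apply: scale_eval1; exact: hS (hr _ ur).
Qed.

Lemma gr_of_scale (a : M) g x : ((gr_of g *: a : M) : D) x = (a : D) (alpha g x).
Proof. by rewrite -[gr_of g *: a]/(dual_scale (gr_of g) a) dual_scaleE gr_sum_gr_of. Qed.

End Action.

(** * The two directions of the equivalence *)

Section Expansiveness.
Variables (R : realType) (G : zmodType) (X : topologicalZmodType).
Variable alpha : aut_action G X.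
Local Notation C := R[i]^o.
Local Notation D := (dual R X).
Local Notation M := (dual_module R alpha).
Hypotheses (cX : compact [set: X]) (mX : metrizable R X).

Lemma nbhs0_chars (N : set X) : nbhs 0 N ->
  exists F : seq D, exists2 e : C, 0 < e &
    forall x, (forall a, a \in F -> `|a x - 1| <= e) -> N x.
Proof.
move=> N0; have [||F [e /andP[e0 _] [_ hF]]] := @chars_isolate R X cX setT (~` N°).
- by apply: open_closedC; exact: open_interior.
- move=> x Nx; have [|a ax] := @metrizable_separated R X cX mX x; last by exists a.
  by apply/eqP => x0; apply: Nx; rewrite x0.
exists F, e => // x hx; apply: interior_subset; apply: contrapT => Nx.
exact: hF hx Nx.
Qed.

(** If finitely many characters F control N, a point annihilated by the submodule they span has its
    whole orbit in N and is 0. The submodule thus separates points. *)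
Lemma expansive_finitely_generated : expansive alpha -> finitely_generated M.
Proof.
move=> /expansiveP[N N0 NE]; have [F [e e0 hF]] := nbhs0_chars N0.
have [m0 meanM] := mean_exists R X.
pose S : set M := [set` (F : seq M)].
exists S; first by apply/finite_seqP; exists F.
apply/generatesE; apply: (@separating_subgroup_full R X cX m0 meanM (lspan S)).
- exact: (@lspan0 _ M).
- exact: (@lspanD _ M).
- exact: (@lspanN _ M).
move=> x hx; apply: NE => g; apply: hF => a aF.
have /hx : lspan S (gr_of g *: (a : M)) by apply: lspanZ; exact: lspan_mem.
by rewrite gr_of_scale => ->; rewrite subrr normr0 ltW.
Qed.

Lemma expansive_no_circle_hom (s : M) (th : G -> C) : expansive alpha ->
  circle_hom th -> ~ (forall f, f *: s = 0 -> gr_sum th f = 0).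
Proof.
move=> ex hth hs.
have [t _ gen] : exists2 t : seq M, (forall a, a \in t -> setT a) & forall m, lspan [set` t] m.
  apply: finite_generating_subset; last exact: expansive_finitely_generated.
  by apply/generatesE => m; exact: lspan_mem.
have phiB : zmod_morphism (fun f : group_ring G => gr_sum th f : R[i]).
  by move=> f g; exact: gr_sumB.
have phiM : monoid_morphism (fun f : group_ring G => gr_sum th f : R[i]).
  by split=> [|f g]; [exact: gr_sum_hom1|exact: gr_sum_homM].
pose mZ := GRing.isZmodMorphism.Build (group_ring G) R[i] _ phiB.
pose mM := GRing.isMonoidMorphism.Build (group_ring G) R[i] _ phiM.
pose phi : {rmorphism group_ring G -> R[i]} :=
  HB.pack (fun f : group_ring G => gr_sum th f : R[i]) mZ mM.
have [psi [psiD psiZ [m0 psi1]]] := @equivariant_functional _ M R[i] phi t s gen hs.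
move: ex => /expansiveP[N N0 NE]; have [F [e e0 hF]] := nbhs0_chars N0.
have [d d0 hd] := cis_near1 e0.
pose B : R := \sum_(a <- F) complex.Re `|psi a|.
(* Small enough for tau |psi a| < d on F, and at most 1 < pi, so that [cis tau] is not 1. *)
pose tau : R := Num.min d 1 / (1 + B).
have Re_norm z : 0 <= complex.Re `|z : R[i]| by rewrite -ler0c RRe_real ?normr_real.
have B0 : 0 <= B by apply: sumr_ge0.
have B1 : 0 < 1 + B by rewrite ltr_pwDl.
have m1 : 0 < Num.min d 1 by rewrite lt_min d0 ltr01.
have tau0 : 0 < tau by rewrite divr_gt0.
have tau1 : tau <= 1.
  rewrite ler_pdivrMr// mul1r (le_trans (_ : _ <= 1))//; last by rewrite lerDl.
  by rewrite ge_min lexx orbT.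
have tauF a : a \in F -> tau * complex.Re `|psi a| < d.
  move=> aF; have aB : complex.Re `|psi a| <= B.
    rewrite /B (perm_big _ (perm_to_rem aF)) big_cons lerDl.
    exact: sumr_ge0.
  rewrite /tau mulrAC ltr_pdivrMr//.
  apply: (@le_lt_trans _ _ (Num.min d 1 * B)); first by rewrite ler_wpM2l// ltW.
  apply: (@lt_le_trans _ _ (Num.min d 1 * (1 + B))).
    by rewrite ltr_pM2l// ltrDr.
  by rewrite ler_wpM2r ?(ltW B1)// ge_min lexx.
pose thD (a : D) : C := cis (tau * complex.Re (psi a)).
have hthD : circle_hom thD.
  split=> [a b|a]; last exact: norm_cis.
  rewrite /thD psiD -cisD -mulrDr; congr (cis (_ * _)).
  exact: (raddfD (@complex.Re R : Rcomplex R -> R)).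
have [mu meanM] := mean_exists R X.
have [x hx] := dual_hom_eval cX meanM hthD.
have x0 : x = 0.
  apply: NE => g; apply: hF => a aF.
  rewrite -(@gr_of_scale _ _ _ alpha a g x) hx /thD psiZ.
  apply/ltW/hd; apply: le_lt_trans (tauF _ aF).
  rewrite normrM gtr0_norm// ler_pM2l// -lecR.
  apply: (le_trans (normc_ge_Re _)); rewrite normrM.
  have -> : `|phi (gr_of g)| = 1 :> R[i].
    by have := hth.2 g; rewrite -[th g](gr_sum_gr_of th).
  by rewrite mul1r RRe_real ?normr_real.
have : cis tau = 1 :> C.
  have := hx m0; rewrite x0 char0 /thD psi1 mulr1 => <-.
  by [].
move=> /cis_eq1 tau00; have : tau = 0.
  by apply: tau00; rewrite gtr0_norm// (le_lt_trans tau1)// (lt_le_trans _ (pi_ge2 R))// ltr1n.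
by move=> t0; rewrite t0 ltxx in tau0.
Qed.

Lemma expansive_of_no_circle_hom (S : set M) : generates S -> finitely_generated M ->
  (forall s (th : G -> C), S s -> circle_hom th ->
     ~ (forall f, f *: s = 0 -> gr_sum th f = 0)) ->
  expansive alpha.
Proof.
move=> gS fg noth.
have [t tS gen] := finite_generating_subset gS fg.
have gap (s : M) : exists F : group_ring G, s \in t -> F *: s = 0 /\
    exists2 e : C, 0 < e & forall th, circle_hom th -> e <= gr_sum th F.
  have [st|] := boolP (s \in t); last by exists 0.
  have [|F hF] := @spectral_gap R G M s; last by exists F.
  move=> th hth; apply: contrapT => nf; apply: (noth _ _ (tS _ st) hth) => f fs.
  by apply/eqP/negPn/negP => f0; apply: nf; exists f.
have [F hF] := choice gap.
pose A (s : M) : R := \sum_(k <- finmap.enum_fset (monalg.msupp (F s))) `|(monalg.mcoeff k (F s))%:~R|.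
have A0 s : 0 <= A s by apply: sumr_ge0.
pose B : R := 1 + \sum_(s <- t) A s.
have B0 : 0 < B by rewrite ltr_pwDl// sumr_ge0.
have AB s : s \in t -> A s < B.
  move=> st; rewrite /B (perm_big _ (perm_to_rem st)) big_cons addrCA ltrDl.
  by rewrite ltr_pwDl// sumr_ge0.
(* B exceeds the l1 norm of each F s, so a lift bounded by eta is taken by F s to values below pi,
   where [cis_eq1] applies. *)
pose eta : R := pi / B.
have eta0 : 0 < eta by rewrite divr_gt0// pi_gt0.
have [d d0 lift] := cis_lift eta0.
apply/expansiveP; exists [set x | forall s : M, s \in t -> `|(s : D) x - 1| < d].
  elim: (t : seq M) => [|s l IH]; first by apply: filterS filterT.
  have s0 : \forall x \near (0 : X), `|(s : D) x - 1| < d.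
    have := @cvgr_dist_lt _ C _ _ (nbhs_filter _) _ _ (@char_continuous R X s 0) _ d0.
    by apply: filterS => x; rewrite char0 distrC.
  apply: filterS2 s0 IH => x sx lx s'; rewrite inE => /predU1P[->//|].
  exact: lx.
move=> x hx.
have eval1 s : s \in t -> forall g, (s : D) (alpha g x) = 1.
  move=> st; have [Fs [e e0 he]] := hF _ st.
  have [u hu] := choice (fun g => (let: ex_intro2 r r1 r2 :=
    lift _ (norm_char (s : D) (alpha g x)) (hx g s st) in
    ex_intro (fun r => `|r| <= eta /\ cis r = (s : D) (alpha g x)) r (conj r1 r2))).
  have usum a : gr_sum (fun k => u (a + k)) (F s) = 0.
    apply: cis_eq1.
      apply: (@le_lt_trans _ _ (eta * A s)).
        rewrite /gr_sum (le_trans (ler_norm_sum _ _ _))// mulr_sumr ler_sum// => k _.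
        by rewrite -mulrzr normrM ler_wpM2r// (hu _).1.
      by rewrite /eta mulrAC ltr_pdivrMr// ltr_pM2l ?pi_gt0// AB.
    rewrite -(@scale_cis _ _ _ alpha s (F s) (alpha a x)) ?Fs// => k.
    by rewrite (hu _).2 addrC act_comp.
  have u0 := @wiener_injective R G (F s) e (fun g => (u g)%:C%C) e0 he.
  have {}u0 g : (u g)%:C%C = 0 :> C.
    apply: u0 => [|a].
      by exists (eta%:C%C) => g'; rewrite normc_def/= expr0n/= addr0 sqrtr_sqr lecR (hu _).1.
    rewrite -[RHS](rmorph0 (real_complex R)) -(usum a).
    by rewrite (gr_sum_morph (real_complex R)).
  by move=> g; rewrite -(hu g).2 (complexI (u0 g)) cis0.
apply/eqP/negPn/negP => x0.
have [a /eqP] := metrizable_separated cX mX x0; apply.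
exact: (lspan_eval1 eval1 (gen (a : M))).
Qed.

End Expansiveness.

Theorem theorem3p3 (R : realType) (G : zmodType) (X : topologicalZmodType)
    (alpha : aut_action G X) (S : set (dual_module R alpha)) :
  countable [set: G] ->
  compact [set: X] ->
  metrizable R X ->
  generates S ->
  expansive alpha <->
    finitely_generated (dual_module R alpha) /\
    (forall s, S s ->
       ~ exists phi : {rmorphism ann_quot s -> R[i]},
           subgroup_of_circle (phi @` image_of_group s)).
Proof.
move=> _ cX mX gS; split=> [ex|[fg nophi]].
  split=> [|s _ [phi /circle_hom_of_ann_quot[th hth hs]]].
    exact: expansive_finitely_generated.
  exact: (expansive_no_circle_hom cX mX ex hth hs).
apply: (expansive_of_no_circle_hom cX mX gS fg) => s th Ss hth hs.
by apply: (nophi s Ss); exact: ann_quot_of_circle_hom hth hs.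
Qed.
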